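(* For each $n\ge1$, let $\boldsymbol{G}_n$ be a uniform random unlabeled circle graph with $n$ vertices (all $\boldsymbol{G}_n$ being defined on a common probability space). Then for all $k\ge1$, as $n\to+\infty$, $$\frac{\#\{\text{cliques of size }k\text{ in }\boldsymbol{G}_n\}}{\binom nk}\longrightarrow\frac{2^k\,k!}{(2k)!}\quad\text{almost surely.}$$ In particular, $\#\{\text{edges of }\boldsymbol{G}_n\}/\binom n2\to\frac13$ and $\#\{\text{triangles of }\boldsymbol{G}_n\}/\binom n3\to\frac1{15}$ almost surely.
   Context: A matching of size $n$ is a fixed-point free involution $\mathfrak m$ on $\{1,\dots,2n\}$; it is represented by the $n$ chords of the unit circle joining $e^{2\mathbf i\pi i/(2n)}$ to $e^{2\mathbf i\pi \mathfrak m(i)/(2n)}$. $G_{\mathfrak m}$ denotes the unlabeled intersection graph of these chords: its vertices are the $n$ chords, two distinct chords being adjacent iff they intersect. A circle graph with $n$ vertices is an unlabeled graph (graph up to isomorphism) equal to $G_{\mathfrak m}$ for some matching $\mathfrak m$ of size $n$. Uniform means uniform over the finite set of unlabeled circle graphs with $n$ vertices. A clique of size $k$ is a set of $k$ pairwise adjacent vertices. *)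

(* Defs.v *)
From HB Require Import structures.
From mathcomp Require Import all_boot all_order all_algebra.
From mathcomp Require Import all_classical all_reals all_analysis.

Set Implicit Arguments.
Unset Strict Implicit.
Unset Printing Implicit Defensive.

Import Order.TTheory GRing.Theory Num.Theory.
Import numFieldNormedType.Exports.

Local Open Scope classical_set_scope.
Local Open Scope quotient_scope.
Local Open Scope ring_scope.

Definition isomorphic (T U : finType) (e : rel T) (f : rel U) : bool :=
  `[< exists2 h : T -> U, bijective h & forall x y, f (h x) (h y) = e x y >].

Lemma isomorphic_refl (T : finType) (e : rel T) : isomorphic e e.
Proof. by apply/asboolP; exists id => //; exists id. Qed.

Lemma isomorphic_sym (T U : finType) (e : rel T) (f : rel U) :
  isomorphic e f = isomorphic f e.
Proof.
suff H (T1 T2 : finType) (a : rel T1) (b : rel T2) :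
    isomorphic a b -> isomorphic b a by apply/idP/idP; exact: H.
case/asboolP => h [g hK gK] hE; apply/asboolP; exists g; first by exists h.
by move=> x y; rewrite -hE !gK.
Qed.

Lemma isomorphic_trans (T U V : finType) (e : rel T) (f : rel U) (g : rel V) :
  isomorphic e f -> isomorphic f g -> isomorphic e g.
Proof.
case/asboolP => h hb hE /asboolP[k kb kE]; apply/asboolP; exists (k \o h).
  exact: bij_comp.
by move=> x y; rewrite /= kE hE.
Qed.

Definition is_sgraph n (g : {ffun 'I_n * 'I_n -> bool}) : bool :=
  [forall x, ~~ g (x, x)] && [forall x, forall y, g (x, y) == g (y, x)].

Definition sgraph n := {g : {ffun 'I_n * 'I_n -> bool} | is_sgraph g}.
HB.instance Definition _ n := Finite.on (sgraph n).

Definition adj n (g : sgraph n) : rel 'I_n := fun x y => val g (x, y).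

Definition sgraph_iso n : rel (sgraph n) :=
  fun g h => isomorphic (adj g) (adj h).

Lemma sgraph_iso_refl n : reflexive (@sgraph_iso n).
Proof. by move=> g; exact: isomorphic_refl. Qed.

Lemma sgraph_iso_sym n : symmetric (@sgraph_iso n).
Proof. by move=> g h; exact: isomorphic_sym. Qed.

Lemma sgraph_iso_trans n : transitive (@sgraph_iso n).
Proof. by move=> h g k; exact: isomorphic_trans. Qed.

Canonical sgraph_iso_equiv n := EquivRel (@sgraph_iso n)
  (@sgraph_iso_refl n) (@sgraph_iso_sym n) (@sgraph_iso_trans n).

Definition ugraph n := {eq_quot (@sgraph_iso n)}.
HB.instance Definition _ n := EqQuotient.on (ugraph n).
HB.instance Definition _ n := Countable.on (ugraph n).
HB.instance Definition _ n := fintype.isFinite.Build (ugraph n)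
  (pcan_enumP (can_pcan (@reprK _ (ugraph n)))).

Definition uadj n (G : ugraph n) : rel 'I_n := adj (repr G).

Lemma uadj_pi n (g : sgraph n) : isomorphic (uadj (\pi_(ugraph n) g)) (adj g).
Proof.
have : \pi_(ugraph n) (repr (\pi_(ugraph n) g)) = \pi_(ugraph n) g.
  by rewrite reprK.
by move/eqmodP.
Qed.

Definition is_matching n (m : {ffun 'I_(2 * n) -> 'I_(2 * n)}) : bool :=
  [forall i, (m (m i) == i) && (m i != i)].

(* 'I_(2 * n) is 0-based: the index i stands for the label i.+1. *)
Definition circle_point (R : realType) n (i : 'I_(2 * n)) : R * R :=
  let theta := 2 * pi * i.+1%:R / (2 * n)%:R in (cos theta, sin theta).

Definition segment (R : realType) (p q : R * R) : set (R * R) :=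
  [set (1 - t) *: p + t *: q | t in `[0, 1]].

(* A chord is named by its pair of endpoint labels. *)
Definition chords n (m : {ffun 'I_(2 * n) -> 'I_(2 * n)}) :
    {set {set 'I_(2 * n)}} :=
  [set [set i; m i]%SET | i in 'I_(2 * n)]%SET.

Definition chord n (m : {ffun 'I_(2 * n) -> 'I_(2 * n)}) :=
  {A : {set 'I_(2 * n)} | A \in chords m}.
HB.instance Definition _ n m := Finite.on (@chord n m).

Definition chord_segment (R : realType) n m (A : @chord n m) : set (R * R) :=
  [set z | exists2 i, i \in val A &
           segment (circle_point R i) (circle_point R (m i)) z].
Arguments chord_segment R {n m} A.

Definition chord_adj (R : realType) n m : rel (@chord n m) :=
  fun A B => (A != B) && `[< chord_segment R A `&` chord_segment R B !=set0 >].

Definition is_circle_graph (R : realType) n (G : ugraph n) : bool :=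
  [exists m, is_matching m && isomorphic (uadj G) (@chord_adj R n m)].

Definition circle_graph (R : realType) n :=
  {G : ugraph n | is_circle_graph R G}.
HB.instance Definition _ R n := Finite.on (@circle_graph R n).

(* The sigma-algebra on the finite type U is the discrete one. *)
Definition uniform_rv (R : realType) (d : measure_display)
    (T : measurableType d) (P : probability T R) (U : finType) (X : T -> U) :=
  forall u : U, measurable (X @^-1` [set u]) /\
                P (X @^-1` [set u]) = (#|U|%:R^-1)%:E.

Definition n_cliques (T : finType) (e : rel T) (k : nat) : nat :=
  #|[set A : {set T} | (#|A| == k) &&
       [forall x in A, forall y in A, (x != y) ==> e x y]]%SET|.

Definition n_edges (T : finType) (e : rel T) : nat :=
  #|[set [set p.1; p.2] | p in [pred p : T * T | e p.1 p.2]]%SET|.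

Definition n_triangles (T : finType) (e : rel T) : nat :=
  #|[set [set t.1.1; t.1.2; t.2] | t in
      [pred t : T * T * T | [&& e t.1.1 t.1.2, e t.1.2 t.2 & e t.1.1 t.2]]]%SET|.

(* The counts do not depend on the representative used by uadj. *)
Lemma n_cliques_iso (T U : finType) (e : rel T) (f : rel U) k :
  isomorphic e f -> n_cliques e k = n_cliques f k.
Proof.
suff H (T1 T2 : finType) (a : rel T1) (b : rel T2) :
    isomorphic a b -> (n_cliques a k <= n_cliques b k)%N.
  by move=> ef; apply/eqP; rewrite eqn_leq !H // isomorphic_sym.
case/asboolP => h /bij_inj hi hE.
rewrite /n_cliques -(card_imset _ (imset_inj hi)); apply/subset_leq_card/fintype.subsetP.
move=> _ /imsetP[A + ->]; rewrite !inE => /andP[Ak /forall_inP cA].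
rewrite card_imset // Ak; apply/forall_inP => _ /imsetP[x xA ->].
apply/forall_inP => _ /imsetP[y yA ->]; rewrite hE (inj_eq hi).
exact: (forall_inP (cA x xA)).
Qed.

Lemma n_edges_iso (T U : finType) (e : rel T) (f : rel U) :
  isomorphic e f -> n_edges e = n_edges f.
Proof.
suff H (T1 T2 : finType) (a : rel T1) (b : rel T2) :
    isomorphic a b -> (n_edges a <= n_edges b)%N.
  by move=> ef; apply/eqP; rewrite eqn_leq !H // isomorphic_sym.
case/asboolP => h /bij_inj hi hE.
rewrite /n_edges -(card_imset _ (imset_inj hi)); apply/subset_leq_card/fintype.subsetP.
move=> _ /imsetP[_ /imsetP[[x y] xy ->] ->]; rewrite imsetU !imset_set1 /=.
by apply/imsetP; exists (h x, h y); rewrite // inE /= hE.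
Qed.

Lemma n_triangles_iso (T U : finType) (e : rel T) (f : rel U) :
  isomorphic e f -> n_triangles e = n_triangles f.
Proof.
suff H (T1 T2 : finType) (a : rel T1) (b : rel T2) :
    isomorphic a b -> (n_triangles a <= n_triangles b)%N.
  by move=> ef; apply/eqP; rewrite eqn_leq !H // isomorphic_sym.
case/asboolP => h /bij_inj hi hE.
rewrite /n_triangles -(card_imset _ (imset_inj hi)).
apply/subset_leq_card/fintype.subsetP.
move=> _ /imsetP[_ /imsetP[[[x y] z] xyz ->] ->].
rewrite !imsetU !imset_set1 /=.
by apply/imsetP; exists (h x, h y, h z); rewrite // inE /= !hE.
Qed.

(* Main.v *)
Require Import Defs.
From HB Require Import structures.
From mathcomp Require Import all_boot all_order all_algebra all_fingroup.
From mathcomp Require Import zify ring lra.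
From mathcomp Require Import all_classical all_reals all_analysis.

Set Implicit Arguments.
Unset Strict Implicit.
Unset Printing Implicit Defensive.

Import Order.TTheory GRing.Theory Num.Theory.
Import numFieldNormedType.Exports.

(** The clique density of a uniform random matching is exponentially
concentrated, and passing from matchings to unlabelled graphs costs only a
polynomial factor.

Concentration.  Label the chords of a matching and their ends.  Among the
(2 k)! ways of placing the ends of k labelled chords on 2 k points, exactly
2 ^ k k! make all chords cross, namely the relabellings of the antipodal
configuration ([card_allcross]); this is the limit in the theorem.  The
k-clique density of a random arrangement is a U-statistic with this mean, and
disjoint blocks of k chords cross independently ([sum_blocks_prod]), so
Hoeffding's argument bounds the proportion of arrangements whose density is
more than eps away from the mean by 2 exp (- c n) ([card_far]).

Polynomial loss.  One graph may come from many matchings: the edgeless graph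
comes from exponentially many.  This must be shown to be untypical, that is,
the number of circle graphs has to be bounded from below.  It suffices to count
labelled circle graphs that are prime for the split decomposition, one chord at
a time.  Given a prime diagram on n chords, a new chord is determined by two
gaps between ends.  If two pairs of gaps give the new vertex the same
neighbourhood, then the four gaps cut the circle into arcs which define a split
of the diagram, and by primeness all four gaps touch a single chord
([four_gaps]).  After the pairs that touch a common chord are discarded, at
least 2 n ^ 2 - 8 n neighbourhoods remain, and each keeps the graph prime
([prime_circle_step]).  Starting from the pentagon, this yields at least
(2 n)! / (K 2 ^ n n ^ 6) labelled prime circle graphs ([card_prime_circle]).

Conclusion.  A graph has at most n! labellings, while the matchings of a circle
graph have at least 2 ^ n n! labelled arrangements.  Hence the proportion of
unlabelled circle graphs with a density more than eps away from the limit is at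
most a constant times n ^ 6 exp (- c n) ([card_far_graphs]).  This is summable,
and the Borel-Cantelli lemma gives almost sure convergence.  Edges and
triangles are the cliques of sizes 2 and 3. *)

(** * Chord placements, splits and gaps *)

Section Crossing.
Variable V : finType.
Implicit Types (f : V * bool -> nat) (i j u z : V).

(** A chord system on [V] is given by the positions [f (z, b)] of the two ends
of each chord [z].  The circle is cut open at infinity, so a cyclic gap between
consecutive ends is named by the end just before it, and the chord with ends in
the gaps after [x] and [y] crosses [z] iff exactly one of [side f (f x) z] and
[side f (f y) z] holds: crossing patterns add like vectors over the field with
two elements. *)
Definition side f t z : bool := (f (z, false) <= t) (+) (f (z, true) <= t).

Definition crossing f : rel V := fun i j =>
  (i != j) && (side f (f (i, false)) j (+) side f (f (i, true)) j).

Lemma dart_neq f i j b c : injective f -> i != j -> f (i, b) != f (j, c).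
Proof. by move=> fI; apply: contra => /eqP/fI[->]. Qed.

Lemma crossing_sym f : injective f -> symmetric (crossing f).
Proof.
move=> fI i j; rewrite /crossing eq_sym; case: (eqVneq j i) => //= ji.
have H b c : f (j, b) != f (i, c) by exact: dart_neq.
rewrite /side.
have E b c : (f (j, b) <= f (i, c)) = ~~ (f (i, c) <= f (j, b)).
  by rewrite -ltnNge ltn_neqAle H.
by rewrite !E; do 4 case: (_ <= _).
Qed.

(** The adjacency matrix between [A] and its complement has rank at most one:
its nonzero rows are all equal. *)
Definition split_rel (e : rel V) (A : {set V}) :=
  forall x x' y y', x \in A -> x' \in A -> y \notin A -> y' \notin A ->
    e x y -> e x' y' -> e x y'.

(** Primeness for the split decomposition: no split has two vertices or more
on both sides. *)
Definition prime_rel (e : rel V) :=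
  forall A : {set V}, split_rel e A -> (#|A| <= 1) || (#|~: A| <= 1).

Lemma split_relC e A : symmetric e -> split_rel e A -> split_rel e (~: A).
Proof.
move=> es eA x x' y y'; rewrite !inE !negbK => xA x'A yA y'A xy x'y'.
by rewrite es; apply: (eA y' y x' x) => //; rewrite es.
Qed.

(** A component [A] with at least two vertices on both sides is itself a split.
Otherwise one side is a single isolated vertex [u], and adding any [w] to it
gives a split whose only possibly nonzero row is that of [w]. *)
Lemma prime_connected e (A : {set V}) : symmetric e -> prime_rel e -> 3 < #|V| ->
  A != finset.set0 -> (forall x y, x \in A -> y \notin A -> ~~ e x y) -> A = finset.setT.
Proof.
move=> es ep V3.
suff H (B : {set V}) : #|B| <= 1 -> B != finset.set0 ->
    (forall x y, x \in B -> y \notin B -> ~~ e x y) -> False.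
  move=> A0 eA; case: (eqVneq (~: A) finset.set0) => [E|CA0].
    by rewrite -(finset.setCK A) E finset.setC0.
  have /orP[A1|A1] : (#|A| <= 1) || (#|~: A| <= 1).
  - by apply: ep => x x' y y' xA _ yA _ xy; rewrite (negPf (eA _ _ xA yA)) in xy.
  - by case: (H A).
  - case: (H (~: A)) => // x y; rewrite !inE negbK => xA yA.
    by rewrite es; apply: eA.
move=> B1 B0 eB.
have {B1 B0}/eqP/cards1P[u Bu] : #|B| = 1 by move: B0; rewrite -card_gt0; lia.
have /card_gt0P[w] : 0 < #|~: [set u]| by rewrite cardsC1; lia.
rewrite !inE => wu.
have /orP[] : (#|[set u; w]| <= 1) || (#|~: [set u; w]| <= 1).
- apply: ep => x x' y y' xA x'A yA y'A xy x'y'.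
  have H z t : z \in [set u; w] -> t \notin [set u; w] -> e z t -> z = w.
    rewrite !inE negb_or => /orP[]/eqP -> // /andP[tu _] ut.
    by have := eB u t; rewrite Bu !inE eqxx tu ut => /(_ isT isT).
  by rewrite (H x y) // -(H x' y').
- by rewrite cards2 eq_sym; case: eqP wu.
- by have := cardsC [set u; w]; rewrite cards2; case: (_ != _); lia.
Qed.

(** The cyclic predecessor of [x] among all ends, so that the gap just before
[x] is the gap just after [gap_pred f x].  Ends smaller than [x] are shifted above
all others before the maximum is taken. *)
Definition gap_pred f (x : V * bool) : V * bool :=
  [arg max_(y > x) (f y + (f y < f x) * (\max_e f e).+1)].

Lemma gap_predP f x : let y := gap_pred f x in
  (f y < f x /\ forall e, f e < f x -> f e <= f y) \/
  (forall e, f x <= f e /\ f e <= f y).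
Proof.
rewrite /gap_pred; case: arg_maxnP => //= y _ yM.
have B e : f e <= \max_e f e by exact: leq_bigmax.
case: (ltnP (f y) (f x)) => yx; [left|right].
  by split => // e ex; have := yM e isT; rewrite ex yx; lia.
move=> e; have := yM e isT; rewrite [f y < _]ltnNge yx /=.
have := B y; move: (\max_e f e) => M.
by case: (ltnP (f e) (f x)) => /=; lia.
Qed.

Lemma gap_pred_between f x y : injective f -> f y < f x ->
  (forall e, f y < f e -> f e <= f x -> e = x) -> y = gap_pred f x.
Proof.
move=> fI yx H; case: (gap_predP f x) => [[px pM]|pM]; last first.
  by have := pM y; lia.
apply: fI; apply/eqP; rewrite eqn_leq pM //= leqNgt; apply/negP => yp.
by move: (px); rewrite (H _ yp) ?ltnn // ltnW.
Qed.

Lemma gap_pred_extremal f x y : injective f ->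
  (forall e, f x <= f e /\ f e <= f y) -> y = gap_pred f x.
Proof.
move=> fI H; case: (gap_predP f x) => [[px pM]|pM].
  by have := H (gap_pred f x); lia.
by apply: fI; have := H (gap_pred f x); have := pM y; lia.
Qed.

(** Sliding a gap over one end toggles the side of that chord only.  This also
holds across the cut at infinity, since every chord has an even number of ends
there. *)
Lemma side_gap_pred f x z : injective f ->
  side f (f (gap_pred f x)) z = side f (f x) z (+) (z == x.1).
Proof.
move=> fI; rewrite /side.
have E e : (f e <= f (gap_pred f x)) =
    ((f e <= f x) (+) (e == x)) (+) ~~ [exists y, f y < f x].
  rewrite -(inj_eq fI); case: (gap_predP f x) => [[px pM]|pM].
    have -> : [exists y, f y < f x] by apply/existsP; exists (gap_pred f x).
    by have := pM e; case: (ltngtP (f e) (f x)); lia.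
  have -> : [exists y, f y < f x] = false.
    by apply/existsP => -[y]; have := pM y; lia.
  by have := pM e; case: (ltngtP (f e) (f x)); lia.
rewrite !E; move: [exists y, f y < f x] {E} => m.
case: x => u b; rewrite !xpair_eqE /=.
by case: (z == u); case: b; case: m => /=; do 2 case: (_ <= _).
Qed.

(** The gap after [x] has an end of [u] on its border. *)
Definition gap_adj f (x : V * bool) u :=
  x \in [:: (u, false); (u, true); gap_pred f (u, false); gap_pred f (u, true)].

Lemma gap_adj_self f x u : x.1 = u -> gap_adj f x u.
Proof. by case: x => [v []] /= ->; rewrite /gap_adj !inE eqxx ?orbT. Qed.

Lemma gap_adj_pred f x u : x.1 = u -> gap_adj f (gap_pred f x) u.
Proof. by case: x => [v []] /= ->; rewrite /gap_adj !inE eqxx ?orbT. Qed.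

Lemma dart_pair (a b e : V * bool) u :
  a.1 = u -> b.1 = u -> e.1 = u -> a <> b -> e = a \/ e = b.
Proof.
case: a => a1 [] /= ->; case: b => b1 [] /= -> //; case: e => e1 [] /= ->; auto.
Qed.

(** The four gaps cut the circle into arcs I1, I2, I3, I4 in cyclic order.
The hypothesis says that no chord joins I1 u I3 to I2 u I4.  A chord inside the
first part crosses one inside the second iff the former joins I1 to I3 and the
latter joins I2 to I4, so the two parts form a split.  By primeness one part is
a single chord [u], whose two ends are then alone on their arcs. *)
Lemma four_gaps_sorted f a b c d : injective f -> prime_rel (crossing f) ->
  f a < f b -> f b < f c -> f c < f d ->
  (forall z, side f (f a) z (+) side f (f b) z (+)
             side f (f c) z (+) side f (f d) z = false) ->
  exists u, [/\ gap_adj f a u, gap_adj f b u, gap_adj f c u & gap_adj f d u].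
Proof.
move=> fI fp ab bc cd H0.
pose I e := (f a < f e <= f b) || (f c < f e <= f d).
have IE z : I (z, true) = I (z, false).
  move: (H0 z); rewrite /side /I; lia.
pose S := [set z | I (z, false)].
have SE e : (e.1 \in S) = I e by rewrite inE; case: e => z [] /=; rewrite ?IE.
pose J2 e := (f a < f e <= f c).
have cmp e g : I g -> ~~ I e ->
    (f e <= f g) = (f e <= f a) (+) ((f c < f g) && J2 e).
  by rewrite /I /J2; lia.
have cr x y : x \in S -> y \notin S -> crossing f x y =
   ((f c < f (x, false)) (+) (f c < f (x, true))) &&
   (J2 (y, false) (+) J2 (y, true)).
  move=> xS yS; have xy : x != y by apply: contraNneq yS => <-.
  have H b1 b2 := cmp (y, b1) (x, b2).
  move: (xS) (yS) (H false false) (H false true) (H true false) (H true true).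
  rewrite /crossing xy /side -!SE /= => -> -> /(_ isT isT)-> /(_ isT isT)->.
  move=> /(_ isT isT)-> /(_ isT isT)->.
  case: (f (y, false) <= f a); case: (f (y, true) <= f a);
  case: (f c < f (x, false)); case: (f c < f (x, true));
  by case: (J2 (y, false)); case: (J2 (y, true)).
have aS : a.1 \notin S by rewrite SE /I; lia.
have cS : c.1 \notin S by rewrite SE /I; lia.
have bS : b.1 \in S by rewrite SE /I; lia.
have dS : d.1 \in S by rewrite SE /I; lia.
have ad (x y : V * bool) : f x < f y -> x <> y by move=> + E; rewrite E ltnn.
have /orP[/card_le1_eqP S1|/card_le1_eqP S1] : (#|S| <= 1) || (#|~: S| <= 1).
- apply: fp => x x' y y' xS x'S yS y'S; rewrite !cr // => /andP[-> _].
  by case/andP.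
- have db : d.1 = b.1 by exact: S1.
  have two e : e.1 \in S -> e = b \/ e = d.
    by move=> eS; apply: (@dart_pair _ _ _ b.1) => //; [exact: S1|apply: ad; lia].
  exists b.1; split; try exact: gap_adj_self.
    rewrite (@gap_pred_between f b a) //; first exact: gap_adj_pred.
    by move=> e e1 e2; case: (two e) => // [|E]; [rewrite SE /I e1 e2|subst e; lia].
  rewrite (@gap_pred_between f d c) //; first exact: gap_adj_pred.
  by move=> e e1 e2; case: (two e) => // [|E]; [rewrite SE /I e1 e2 orbT|subst e; lia].
- have ca : c.1 = a.1 by apply: S1; rewrite inE.
  have two e : e.1 \notin S -> e = a \/ e = c.
    move=> eS; apply: (@dart_pair _ _ _ a.1) => //; last by apply: ad; lia.
    by apply: S1; rewrite inE.
  exists a.1; split; try exact: gap_adj_self.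
    rewrite (@gap_pred_between f c b) //; first exact: gap_adj_pred.
    move=> e e1 e2; case: (two e) => // [|E]; first by rewrite SE /I; lia.
    by subst e; lia.
  rewrite (@gap_pred_extremal f a d) //; first exact: gap_adj_pred.
  move=> e; case: (leqP (f a) (f e)) => e1; case: (leqP (f e) (f d)) => e2 //;
    (case: (two e) => [|E|E]; [by rewrite SE /I; lia|by subst e; lia..]).
Qed.

(** Otherwise the chords with an end between [x] and [y] have both ends there,
and form a union of components. *)
Lemma side_inj f x y : injective f -> prime_rel (crossing f) -> 3 < #|V| ->
  (forall z, side f (f x) z = side f (f y) z) -> x = y.
Proof.
move=> fI fp V3.
wlog xy : x y / f x < f y => [hw H|H].
  by case: (ltngtP (f x) (f y)) => [/hw|/hw E|/fI//]; [apply|symmetry; apply: E].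
pose I e := f x < f e <= f y.
have IE z : I (z, true) = I (z, false) by move: (H z); rewrite /side /I; lia.
pose S := [set z | I (z, false)].
have SE e : (e.1 \in S) = I e by rewrite inE; case: e => z [] /=; rewrite ?IE.
have xS : x.1 \notin S by rewrite SE /I; lia.
have yS : y.1 \in S by rewrite SE /I; lia.
suff ST : S = finset.setT by rewrite ST inE in xS.
apply: (@prime_connected (crossing f)) => //; first exact: crossing_sym.
  by apply/set0Pn; exists y.1.
move=> z t zS tS; rewrite /crossing /side negb_and; apply/orP; right.
have := SE (z, false); have := SE (z, true); have := SE (t, false).
have := SE (t, true); rewrite /= zS (negPf tS) /I; lia.
Qed.

(** Two gap pairs with the same crossing pattern coincide or touch one common
chord.  This is what makes the insertion of a chord into a prime diagram
almost injective. *)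
Lemma four_gaps f x y c d : injective f -> prime_rel (crossing f) -> 3 < #|V| ->
  (forall z, side f (f x) z (+) side f (f y) z =
             side f (f c) z (+) side f (f d) z) ->
  [\/ x = y, (x = c /\ y = d) \/ (x = d /\ y = c) |
   exists u, [/\ gap_adj f x u, gap_adj f y u, gap_adj f c u & gap_adj f d u]].
Proof.
move=> fI fp V3 H.
have inj := side_inj fI fp V3.
have H' z : side f (f x) z (+) side f (f y) z (+)
             side f (f c) z (+) side f (f d) z = false.
  by rewrite H -addbA addbb.
case: (eqVneq x y) => [->|xy]; first by constructor 1.
case: (eqVneq x c) => [E|xc].
  constructor 2; left; split => //; apply: inj => z.
  by have := H z; rewrite E; apply: addbI.
case: (eqVneq x d) => [E|xd].
  constructor 2; right; split => //; apply: inj => z.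
  by have := H z; rewrite E [RHS]addbC; apply: addbI.
case: (eqVneq y c) => [E|yc].
  case/eqP: xd; apply: inj => z.
  by have := H z; rewrite E [RHS]addbC; apply: addIb.
case: (eqVneq y d) => [E|yd].
  by case/eqP: xc; apply: inj => z; have := H z; rewrite E; apply: addIb.
case: (eqVneq c d) => [E|cd].
  by case/eqP: xy; apply: inj => z; have := H z; rewrite E addbb; do 2 case: side.
constructor 3.
have S a1 a2 a3 a4 : f a1 < f a2 -> f a2 < f a3 -> f a3 < f a4 ->
    perm_eq [:: x; y; c; d] [:: a1; a2; a3; a4] ->
    exists u, [/\ gap_adj f x u, gap_adj f y u, gap_adj f c u & gap_adj f d u].
  move=> l1 l2 l3 pe.
  have [z|u [u1 u2 u3 u4]] := @four_gaps_sorted f a1 a2 a3 a4 fI fp l1 l2 l3.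
    have := H' z; have : \big[addb/false]_(e <- [:: x; y; c; d]) side f (f e) z =
        \big[addb/false]_(e <- [:: a1; a2; a3; a4]) side f (f e) z.
      exact: perm_big.
    by rewrite !big_cons !big_nil !addbF !addbA => <-.
  have A : all (gap_adj f ^~ u) [:: x; y; c; d].
    by rewrite (perm_all _ pe) /= u1 u2 u3 u4.
  by exists u; move: A => /= /and5P[].
(* The hypothesis is symmetric in the four gaps, which may thus be sorted. *)
pose s := sort (relpre f leq) [:: x; y; c; d].
have ps : perm_eq s [:: x; y; c; d] by rewrite perm_sort.
have us : uniq s by rewrite (perm_uniq ps) /= !inE !negb_or xy xc xd yc yd cd.
have ss : sorted (relpre f ltn) s.
  rewrite -sorted_map ltn_sorted_uniq_leq map_inj_uniq // us sorted_map.
  by apply: sort_sorted => a b; exact: leq_total.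
have := perm_size ps; move: s ps us ss => [|a1[|a2[|a3[|a4[|]]]]] //= ps _.
case/and4P => l1 l2 l3 _ _; apply: (S a1 a2 a3 a4) => //.
by rewrite perm_sym.
Qed.

(** Gap pairs touching a common chord [u] are discarded: they create a twin of
[u], a pendant vertex at [u], or an isolated vertex. *)
Definition good_gaps f (x y : V * bool) :=
  ~~ [exists u, gap_adj f x u && gap_adj f y u].

(** Outside [u], the pattern of an isolated or pendant vertex is that of the
gap pair around one end of [u], and the pattern of a twin is that of the gaps at
its two ends.  The value at [u] is adjusted by sliding one of these gaps over an
end of [u]; [four_gaps] then says that the given gaps also touch [u]. *)
Lemma good_gaps_nbhd f x y u : injective f -> prime_rel (crossing f) ->
  3 < #|V| -> good_gaps f x y ->
  (exists2 z, z != u & side f (f x) z (+) side f (f y) z) /\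
  (exists2 z, z != u & side f (f x) z (+) side f (f y) z != crossing f u z).
Proof.
move=> fI fp V3 gxy.
have ngap v : gap_adj f x v -> gap_adj f y v -> False.
  by move=> xv yv; case/negP: gxy; apply/existsP; exists v; rewrite xv.
have main (c d : V * bool) : gap_adj f c u -> gap_adj f d u ->
    ~ forall z, side f (f x) z (+) side f (f y) z =
                side f (f c) z (+) side f (f d) z.
  move=> cu du /(four_gaps fI fp V3)[xy|[[xc yd]|[xd yc]]|[v [xv yv _ _]]].
  - by apply: (@ngap x.1); rewrite -?xy; exact: gap_adj_self.
  - by apply: (@ngap u); rewrite ?xc ?yd.
  - by apply: (@ngap u); rewrite ?xd ?yc.
  - exact: (@ngap v).
have main2 (c d : V * bool) : c.1 = u -> d.1 = u ->
    exists2 z, z != u & side f (f x) z (+) side f (f y) z !=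
                side f (f c) z (+) side f (f d) z.
  move=> cu du; case: (pickP (fun z => (z != u) && (side f (f x) z (+) side f (f y) z
     != side f (f c) z (+) side f (f d) z))) => [z /andP[]|H]; first by exists z.
  have {}H z : z != u -> side f (f x) z (+) side f (f y) z =
                side f (f c) z (+) side f (f d) z.
    by move=> zu; apply/eqP; apply: contraFT (H z) => D; apply/andP.
  exfalso; case: (eqVneq (side f (f x) u (+) side f (f y) u)
                (side f (f c) u (+) side f (f d) u)) => E.
    apply: (@main c d); try exact: gap_adj_self.
    by move=> z; case: (eqVneq z u) => [->|/H].
  apply: (@main c (gap_pred f d)); [exact: gap_adj_self|exact: gap_adj_pred|].
  move=> z; rewrite side_gap_pred // du; case: (eqVneq z u) => [->|/H ->].
    by move: E; do 4 case: side.
  by rewrite addbF.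
split.
  have [z zu] := main2 (u, false) (u, false) erefl erefl.
  by rewrite addbb eqbF_neg negbK; exists z.
have [z zu H] := main2 (u, false) (u, true) erefl erefl.
by exists z => //; rewrite /crossing [u == z]eq_sym zu.
Qed.

(** Each chord has at most four gaps at its ends, hence forbids at most sixteen
ordered pairs. *)
Lemma card_good_gaps f :
  (2 * #|V|) ^ 2 <= #|[set p | good_gaps f p.1 p.2]| + 16 * #|V|.
Proof.
have -> : (2 * #|V|) ^ 2 = #|{: (V * bool) * (V * bool)}|.
  by rewrite !card_prod card_bool mulnC.
rewrite -(cardsC [set p | good_gaps f p.1 p.2]) leq_add2l.
have -> : ~: [set p | good_gaps f p.1 p.2] =
    \bigcup_u finset.setX [set x | gap_adj f x u] [set x | gap_adj f x u].
  apply/finset.setP => -[x y]; rewrite !inE negbK /=.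
  apply/existsP/bigcupP => [[u H]|[u _ H]]; exists u => //; move: H;
  by rewrite !inE.
apply: (@leq_trans (\sum_(u : V) 16)); last by rewrite sum_nat_const mulnC.
apply: (@leq_trans (\sum_u #|finset.setX [set x | gap_adj f x u] [set x | gap_adj f x u]|)).
  elim/big_rec2: _ => [|u m A _ IH]; first by rewrite cards0.
  by apply: leq_trans (leq_card_setU _ _) _; rewrite leq_add2l.
apply: leq_sum => u _; rewrite cardsX; apply: (@leq_mul _ _ 4 4);
by rewrite cardsE; exact: card_size.
Qed.

End Crossing.

(** * Inserting a chord preserves primeness *)

Section Extension.
Variable n : nat.
Implicit Types (e : rel 'I_n) (N : pred 'I_n) (f : 'I_n * bool -> nat).

Definition ext_rel e N : rel 'I_n.+1 := fun x y =>
  match unlift ord_max x, unlift ord_max y with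
  | Some a, Some b => e a b
  | Some a, None => N a
  | None, Some b => N b
  | None, None => false
  end.

Lemma ext_rel_sym e N : symmetric e -> symmetric (ext_rel e N).
Proof.
move=> es x y; rewrite /ext_rel.
by case: unliftP => [a|] _; case: unliftP => [b|] _.
Qed.

(** Deleting the new vertex from a split of the extension leaves a split of [e],
so a nontrivial split has the form {new, u} against the rest.  Its two rows,
[N] and [e u], would then be zero or equal outside [u]. *)
Lemma prime_ext e N : symmetric e -> prime_rel e -> 3 < n ->
  (forall u, exists2 z, z != u & N z) ->
  (forall u, exists2 z, z != u & N z != e u z) -> prime_rel (ext_rel e N).
Proof.
move=> es ep n3 N0 Ne A eA.
wlog vA : A eA / ord_max \in A => [hw|].
  case: (boolP (ord_max \in A)) => vA; first exact: hw.
  rewrite orbC -{2}(finset.setCK A); apply: hw; last by rewrite inE.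
  by apply: split_relC => //; exact: ext_rel_sym.
rewrite leqNgt; case: (leqP #|~: A|) => CA; rewrite ?orbT // orbF -leqNgt.
pose B := [set z | lift ord_max z \in A].
have cA : #|A| = #|B|.+1.
  rewrite (cardsD1 ord_max) vA; congr _.+1.
  rewrite -(card_imset _ (@lift_inj _ ord_max)); apply: eq_card => z.
  rewrite !inE; apply/andP/imsetP => [[zv zA]|[w]]; last first.
    by rewrite inE => wA ->; rewrite eq_sym neq_lift.
  by case: (unliftP ord_max z) zv zA => [w ->|->]; rewrite ?eqxx // => _ wA;
     exists w; rewrite ?inE.
have cCA : #|~: A| = #|~: B|.
  by have := cardsC A; have := cardsC B; rewrite !card_ord cA; lia.
have eE (x y : 'I_n) : ext_rel e N (lift ord_max x) (lift ord_max y) = e x y.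
  by rewrite /ext_rel !liftK.
have nE (y : 'I_n) : ext_rel e N ord_max (lift ord_max y) = N y.
  by rewrite /ext_rel unlift_none liftK.
have /orP[B1|] : (#|B| <= 1) || (#|~: B| <= 1).
- apply: ep => x x' y y'; rewrite !inE => xB x'B yB y'B xy x'y'.
  by rewrite -eE; apply: (eA _ (lift ord_max x') (lift ord_max y)); rewrite ?eE.
- rewrite cA; case: (posnP #|B|) => [-> //|B0].
  have /eqP/cards1P[u Bu] : #|B| = 1 by lia.
  have uA : lift ord_max u \in A by have := set11 u; rewrite -Bu inE.
  have yA z : z != u -> lift ord_max z \notin A.
    by move=> zu; have : z \notin B by [rewrite Bu inE]; rewrite inE.
  have [z zu Nz] := N0 u; have [t tu Nt] := Ne u.
  have [w wu uw] : exists2 w, w != u & e u w.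
    case: (pickP (fun w => (w != u) && e u w)) => [w /andP[]|H]; first by exists w.
    have : [set u] = finset.setT.
      apply: (@prime_connected _ e) => //; rewrite ?card_ord //.
        by apply/set0Pn; exists u; rewrite inE.
      by move=> x y; rewrite !inE => /eqP-> yu; have := H y; rewrite yu /= => ->.
    by move=> E; have := cards1 u; rewrite E cardsT card_ord; lia.
  case: (boolP (N t)) Nt => Nt; last first.
    rewrite eq_sym eqbF_neg negbK => ut; case/negP: Nt; rewrite -nE.
    apply: (eA _ (lift ord_max u) (lift ord_max z)); rewrite ?yA ?nE ?eE //.
  rewrite eq_sym eqb_id => /negP[]; rewrite -eE.
  apply: (eA _ ord_max (lift ord_max w)); rewrite ?yA ?nE ?eE //.
- by rewrite -cCA; lia.
Qed.

(** Doubling all positions makes room, at odd positions, for the two new ends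
right after [x] and [y]. *)
Definition ext_pos f (x y : 'I_n * bool) (d : 'I_n.+1 * bool) : nat :=
  if unlift ord_max d.1 is Some z then (f (z, d.2)).*2
  else (f (if d.2 then y else x)).*2.+1.

Lemma ext_pos_inj f x y : injective f -> x != y -> injective (ext_pos f x y).
Proof.
move=> fI xy [a b] [c d]; rewrite /ext_pos /=.
case: unliftP => [a'|] ->; case: unliftP => [c'|] -> E.
- by have /fI[-> ->] := double_inj E.
- by have := congr1 odd E; rewrite /= !odd_double.
- by have := congr1 odd E; rewrite /= !odd_double.
case: E => /double_inj/fI E.
by case: b d E => [] [] // E; rewrite E eqxx in xy.
Qed.

Lemma crossing_ext f x y : injective f -> x != y ->
  crossing (ext_pos f x y) =2
  ext_rel (crossing f) (fun z => side f (f x) z (+) side f (f y) z).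
Proof.
move=> fI xy i j.
have pl a b : ext_pos f x y (lift ord_max a, b) = (f (a, b)).*2.
  by rewrite /ext_pos /= liftK.
have pm b : ext_pos f x y (ord_max, b) = (f (if b then y else x)).*2.+1.
  by rewrite /ext_pos /= unlift_none.
have S0 c t : side (ext_pos f x y) c.*2 (lift ord_max t) = side f c t.
  by rewrite /side !pl !leq_double.
have S1 c t : side (ext_pos f x y) c.*2.+1 (lift ord_max t) = side f c t.
  have H (a b : nat) : (a.*2 <= b.*2.+1) = (a <= b) by lia.
  by rewrite /side !pl !H.
have fm t : crossing (ext_pos f x y) ord_max (lift ord_max t) =
    side f (f x) t (+) side f (f y) t.
  by rewrite /crossing neq_lift !pm !S1.
rewrite /ext_rel; case: unliftP => [a|] ->; case: unliftP => [b|] -> //.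
- by rewrite /crossing !pl !S0 (inj_eq lift_inj).
- by rewrite crossing_sym ?fm //; exact: ext_pos_inj.
- by rewrite /crossing eqxx.
Qed.

End Extension.

(** * Counting labelled prime circle graphs *)

Definition prime_circle n : {set {ffun 'I_n * 'I_n -> bool}} :=
  [set g : {ffun 'I_n * 'I_n -> bool} | `[< prime_rel (fun x y => g (x, y)) /\
     exists2 f : 'I_n * bool -> nat, injective f &
       forall x y, g (x, y) = crossing f x y >]].

Lemma prime_circleP n (g : {ffun 'I_n * 'I_n -> bool}) :
  reflect (prime_rel (fun x y => g (x, y)) /\
     exists2 f : 'I_n * bool -> nat, injective f &
       forall x y, g (x, y) = crossing f x y) (g \in prime_circle n).
Proof. by rewrite inE; exact: asboolP. Qed.

Lemma prime_rel_ext (V : finType) (e e' : rel V) :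
  e =2 e' -> prime_rel e -> prime_rel e'.
Proof.
move=> E ep A eA; apply: ep => x x' y y' *; rewrite E.
by apply: (eA x x' y y') => //; rewrite -E.
Qed.

Definition ext_graph n (p : {ffun 'I_n * 'I_n -> bool} * {ffun 'I_n -> bool}) :
    {ffun 'I_n.+1 * 'I_n.+1 -> bool} :=
  [ffun q => ext_rel (fun x y => p.1 (x, y)) p.2 q.1 q.2].

Lemma ext_graph_inj n : injective (@ext_graph n).
Proof.
move=> [g N] [h M] /ffunP E; congr pair; apply/ffunP.
  move=> [x y]; have := E (lift ord_max x, lift ord_max y).
  by rewrite !ffunE /ext_rel /= !liftK.
move=> x; have := E (ord_max, lift ord_max x).
by rewrite !ffunE /ext_rel /= unlift_none !liftK.
Qed.

(** Of the 4 n ^ 2 ordered gap pairs at least 4 n ^ 2 - 16 n are good, each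
extends the graph to a prime one, and a neighbourhood comes from at most two
of them, a pair and its reverse. *)
Lemma card_nbhds_prime_circle n (g : {ffun 'I_n * 'I_n -> bool}) : 4 < n ->
  g \in prime_circle n ->
  2 * n ^ 2 - 8 * n <= #|[set N | ext_graph (g, N) \in prime_circle n.+1]|.
Proof.
move=> n4 /prime_circleP[gp [f fI gf]].
have fp : prime_rel (crossing f) by apply: prime_rel_ext gp => x y; rewrite -gf.
have n3 : 3 < #|'I_n| by rewrite card_ord; lia.
pose nb (p : ('I_n * bool) * ('I_n * bool)) : {ffun 'I_n -> bool} :=
  [ffun z => side f (f p.1) z (+) side f (f p.2) z].
pose Q := [set p | good_gaps f p.1 p.2].
have QX : nb @: Q \subset [set N | ext_graph (g, N) \in prime_circle n.+1].
  apply/fintype.subsetP => _ /imsetP[[x y] xyQ ->].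
  have xy : good_gaps f x y by move: xyQ; rewrite inE.
  have xNy : x != y.
    apply/eqP => E; case/negP: xy; apply/existsP; exists x.1; rewrite -E.
    by rewrite gap_adj_self.
  have E : crossing (ext_pos f x y) =2
      (fun i j => ext_graph (g, nb (x, y)) (i, j)).
    move=> i j; rewrite crossing_ext // ffunE /ext_rel /=.
    by case: unliftP => [a|] _; case: unliftP => [b|] _; rewrite ?gf ?ffunE.
  rewrite inE; apply/prime_circleP; split; last first.
    by exists (ext_pos f x y); [exact: ext_pos_inj|move=> i j; rewrite E].
  apply: (prime_rel_ext E).
  apply: (@prime_rel_ext _ (ext_rel (crossing f) (nb (x, y)))).
    move=> i j; rewrite crossing_ext // /ext_rel.
    by case: unliftP => [a|] _; case: unliftP => [b|] _; rewrite ?gf ?ffunE.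
  apply: prime_ext => //; [exact: crossing_sym|by rewrite card_ord in n3| |].
    move=> u; have [[z zu H] _] := good_gaps_nbhd u fI fp n3 xy.
    by exists z; rewrite ?ffunE.
  move=> u; have [_ [z zu H]] := good_gaps_nbhd u fI fp n3 xy.
  by exists z; rewrite ?ffunE.
apply: leq_trans (subset_leq_card QX).
suff : #|Q| <= 2 * #|nb @: Q|.
  by have := card_good_gaps f; rewrite card_ord -/Q; lia.
rewrite -sum1_card (partition_big_imset nb) /= mulnC -sum_nat_const.
apply: leq_sum => _ /imsetP[[c d] cdQ ->].
rewrite sum1_card; apply: (@leq_trans #|[set (c, d); (d, c)]|); last first.
  by rewrite cards2; case: (_ != _).
apply: subset_leq_card; apply/fintype.subsetP => -[x y].
rewrite unfold_in /= => /andP[xyQ /eqP/ffunP E]; rewrite !inE !xpair_eqE.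
have ngap v : gap_adj f x v -> gap_adj f y v -> False.
  by move: xyQ; rewrite inE => /negP N xv yv; apply: N; apply/existsP; exists v; rewrite xv.
case: (@four_gaps _ f x y c d) => //.
- by move=> z; have := E z; rewrite !ffunE.
- by move=> xy; case: (@ngap x.1); rewrite -?xy; exact: gap_adj_self.
- by move=> [[-> ->]|[-> ->]]; rewrite !eqxx ?orbT.
- by move=> [v [xv yv _ _]]; case: (ngap v).
Qed.

Lemma prime_circle_step n : 4 < n ->
  #|prime_circle n| * (2 * n ^ 2 - 8 * n) <= #|prime_circle n.+1|.
Proof.
move=> n4.
pose E := [set p | (p.1 \in prime_circle n) && (ext_graph p \in prime_circle n.+1)].
have : #|E| <= #|prime_circle n.+1|.
  rewrite -(card_imset _ (@ext_graph_inj n)); apply: subset_leq_card.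
  by apply/fintype.subsetP => _ /imsetP[p pE ->]; move: pE; rewrite inE => /andP[].
apply: leq_trans.
rewrite -sum_nat_const -sum1_card.
rewrite (eq_bigl (fun p => (p.1 \in prime_circle n) &&
  (ext_graph (p.1, p.2) \in prime_circle n.+1))); last first.
  by move=> [g N]; rewrite inE.
rewrite -(pair_big_dep (fun g => g \in prime_circle n)
  (fun g N => ext_graph (g, N) \in prime_circle n.+1) (fun _ _ => 1)) /=.
apply: leq_sum => g gP; rewrite sum1_card.
by have := card_nbhds_prime_circle n4 gP; rewrite cardsE.
Qed.

(** Chord [i] joins the points 2 i and 2 i + 3 of a 10-point circle: the
crossing graph is the 5-cycle, the smallest prime graph. *)
Definition pentagon_pos (d : 'I_5 * bool) : nat :=
  if d.2 then (2 * d.1 + 3) %% 10 else 2 * d.1.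

Lemma pentagon_pos_inj : injective pentagon_pos.
Proof.
move=> [i b] [j c]; rewrite /pentagon_pos /= => E.
have [-> /val_inj ->] : b = c /\ i = j :> nat; last by [].
have := ltn_ord i; have := ltn_ord j.
by case: b c E => [] [] /=; lia.
Qed.

Lemma pentagon_crossing (i j : 'I_5) : crossing pentagon_pos i j =
  (j == i.+1 %% 5 :> nat) || (i == j.+1 %% 5 :> nat).
Proof.
by case: i => [[|[|[|[|[|]]]]] ?] //; case: j => [[|[|[|[|[|]]]]] ?].
Qed.

Lemma pentagon_prime : prime_rel (crossing pentagon_pos).
Proof.
(* The split condition on the indicator sequence of a vertex set; the 32
   sequences are checked by computation. *)
pose chk (s : seq bool) := all (fun i => all (fun i' => all (fun j => all (fun j' =>
  [&& nth false s i, nth false s i', ~~ nth false s j, ~~ nth false s j',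
     (j == i.+1 %% 5) || (i == j.+1 %% 5) & (j' == i'.+1 %% 5) || (i' == j'.+1 %% 5)]
  ==> ((j' == i.+1 %% 5) || (i == j'.+1 %% 5))) (iota 0 5)) (iota 0 5)) (iota 0 5)) (iota 0 5).
have chkP a b c d e : chk [:: a; b; c; d; e] ->
    (a + b + c + d + e <= 1) || (5 <= 1 + (a + b + c + d + e)).
  by case: a; case: b; case: c; case: d; case: e; vm_compute.
move=> A eA; pose a i := inord i \in A.
have cA : #|A| = a 0 + a 1 + a 2 + a 3 + a 4.
  rewrite -sum1_card big_mkcond (eq_bigr (fun i : 'I_5 => nat_of_bool (a i))).
    by rewrite !big_ord_recl big_ord0 /= !addnA addn0.
  by move=> i _; rewrite /a inord_val; case: (i \in A).
have := cardsC A; rewrite card_ord cA => cC.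
suff /chkP : chk [:: a 0; a 1; a 2; a 3; a 4] by lia.
have H i i' j j' : i < 5 -> i' < 5 -> j < 5 -> j' < 5 ->
  [&& a i, a i', ~~ a j, ~~ a j',
     (j == i.+1 %% 5) || (i == j.+1 %% 5) & (j' == i'.+1 %% 5) || (i' == j'.+1 %% 5)]
  ==> ((j' == i.+1 %% 5) || (i == j'.+1 %% 5)).
  move=> i5 i'5 j5 j'5; apply/implyP => /and5P[ai ai' aj aj' /andP[ij ij']].
  have := eA (inord i) (inord i') (inord j) (inord j') ai ai' aj aj'.
  by rewrite !pentagon_crossing !inordK //; apply.
have N i : i < 5 -> nth false [:: a 0; a 1; a 2; a 3; a 4] i = a i.
  by case: i => [|[|[|[|[|]]]]].
do 4 (apply/allP => ?; rewrite mem_iota => /andP[_ ?]).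
by rewrite !N //; apply: H.
Qed.

Lemma prime_circle5 : 0 < #|prime_circle 5|.
Proof.
apply/card_gt0P; exists [ffun p => crossing pentagon_pos p.1 p.2].
apply/prime_circleP; split.
  by apply: prime_rel_ext pentagon_prime => x y; rewrite ffunE.
by exists pentagon_pos; [exact: pentagon_pos_inj|move=> x y; rewrite ffunE].
Qed.

(** The number (2 n)! / 2 ^ n of labelled arrangements grows by the factor
(n + 1)(2 n + 1), the lower bound of [prime_circle_step] by 2 n (n - 4).  The
quotients multiply to a polynomial loss, absorbed by
q n = n ^ 2 (n - 1)(n - 2)(n - 3)(n - 4). *)
Lemma card_prime_circle : exists K, forall n, 4 < n ->
  (2 * n)`! <= K * (2 ^ n * n ^ 6 * #|prime_circle n|).
Proof.
(* K is kept abstract, since it is too large a unary number to be computed. *)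
have ex m : exists K, m <= K by exists m.
have [K K5] := ex (2 * 5)`!.
exists K => n n4.
pose q m := m * m * (m - 1) * (m - 2) * (m - 3) * (m - 4).
apply: (@leq_trans (K * (2 ^ n * q n * #|prime_circle n|))); last first.
  rewrite leq_mul2l leq_mul2r leq_mul2l; apply/orP; right; apply/orP; right.
  apply/orP; right; rewrite !expnS expn0 muln1 !mulnA /q.
  by rewrite !leq_mul ?leq_subr.
elim: n n4 => [//|n IH]; rewrite ltnS leq_eqVlt => /orP[/eqP <-|n4].
  apply: (leq_trans K5); apply: leq_pmulr; rewrite muln_gt0 prime_circle5.
  by rewrite !muln_gt0 /q.
rewrite mulnS !factS; apply: leq_trans (leq_mul (leqnn _) (leq_mul (leqnn _) (IH n4))) _.
rewrite expnS; move: (prime_circle_step n4) (2 ^ n) => S e.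
apply: (@leq_trans (K * (2 * e * q n.+1 * (#|prime_circle n| * (2 * n ^ 2 - 8 * n))))).
  have Q : (2 * n).+2 * (2 * n).+1 * q n <= 2 * q n.+1 * (2 * n ^ 2 - 8 * n).
    have -> : 2 * n ^ 2 - 8 * n = 2 * (n * (n - 4)) by rewrite mulnBr; lia.
    rewrite /q -(subnK n4); move: (n - 5) => m.
    have [-> -> -> -> ->] : [/\ m + 5 - 1 = m + 4, m + 5 - 2 = m + 3,
      m + 5 - 3 = m + 2, m + 5 - 4 = m + 1 & (m + 5).+1 - 1 = m + 5] by split; lia.
    have [-> -> ->] : [/\ (m + 5).+1 - 2 = m + 4, (m + 5).+1 - 3 = m + 3 &
      (m + 5).+1 - 4 = m + 2] by split; lia.
    pose X := (m + 5) * (m + 5) * (m + 4) * (m + 3) * (m + 2) * (m + 1).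
    apply: (@leq_trans (4 * (m + 6) ^ 2 * X)); last first.
      by apply: eq_leq; rewrite /X; ring.
    by rewrite leq_mul2r; apply/orP; right; lia.
  have H := leq_mul (leqnn (K * e * #|prime_circle n|)) Q.
  by apply: leq_trans (leq_trans H _); apply: eq_leq; ring.
by rewrite leq_mul2l leq_mul2l S !orbT.
Qed.

(** * Relabellings and the probability that k chords pairwise cross *)

Lemma crossing_mono (V : finType) (f f' : V * bool -> nat) :
  (forall d e, (f d <= f e) = (f' d <= f' e)) -> crossing f =2 crossing f'.
Proof. by move=> H i j; rewrite /crossing /side !H. Qed.

Lemma rank_exists (D : finType) (f : D -> nat) : injective f ->
  exists2 r : D -> 'I_#|D|, injective r & forall d e, (r d <= r e) = (f d <= f e).
Proof.
move=> fI; have rP d : #|[set e | f e < f d]| < #|D|.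
  rewrite -cardsT; apply: proper_card; apply/properP; split => //.
  by exists d; rewrite !inE ?ltnn.
have rm d e : (#|[set x | f x < f d]| <= #|[set x | f x < f e]|) = (f d <= f e).
  case: (leqP (f d) (f e)) => [de|ed].
    apply: subset_leq_card; apply/fintype.subsetP => x; rewrite !inE => xd.
    exact: leq_trans de.
  apply/negbTE; rewrite -ltnNge; apply: proper_card; apply/properP; split.
    by apply/fintype.subsetP => x; rewrite !inE => xe; apply: ltn_trans ed.
  by exists e; rewrite !inE ?ltnn.
exists (fun d => Ordinal (rP d)) => // d e /(congr1 val) /= E; apply: fI.
by apply/eqP; rewrite eqn_leq -!rm E !leqnn.
Qed.

Lemma order_perm (D : finType) (f f' : D -> nat) : injective f -> injective f' ->
  exists g : {perm D}, forall d e, (f (g d) <= f (g e)) = (f' d <= f' e).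
Proof.
move=> /rank_exists[r rI rf] /rank_exists[r' r'I r'f'].
have [q qr rq] : bijective r by apply: inj_card_bij => //; rewrite card_ord.
have gI : injective (fun d => q (r' d)).
  by move=> d e /(congr1 r); rewrite !rq => /r'I.
by exists (perm gI) => d e; rewrite -rf !permE !rq r'f'.
Qed.

Lemma card_permT (V : finType) : #|{perm V}| = (#|V|)`!.
Proof.
have := card_perm [set: V]; rewrite cardsT => <-; apply: eq_card => s.
by apply/esym/fintype.subsetP => x; rewrite inE.
Qed.

(** The hyperoctahedral group: permute the chords and exchange the two ends of
some of them. *)
Section Wreath.
Variable V : finType.
Implicit Types p : {perm V} * {ffun V -> bool}.

Definition wreath_fun p (d : V * bool) := (p.1 d.1, d.2 (+) p.2 d.1).

Lemma wreath_fun_inj p : injective (wreath_fun p).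
Proof. by move=> [i b] [j c] [/perm_inj -> /addIb ->]. Qed.

Definition wreath p : {perm V * bool} := perm (@wreath_fun_inj p).

Lemma wreathE p i b : wreath p (i, b) = (p.1 i, b (+) p.2 i).
Proof. by rewrite permE. Qed.

Lemma wreath_inj : injective wreath.
Proof.
move=> [s a] [t b] /permP E; congr pair.
  by apply/permP => i; have := E (i, false); rewrite !wreathE => -[].
by apply/ffunP => i; have := E (i, false); rewrite !wreathE => -[].
Qed.

Lemma card_wreath : #|[set: {perm V} * {ffun V -> bool}]| = 2 ^ #|V| * (#|V|)`!.
Proof.
rewrite cardsT card_prod card_ffun card_bool mulnC; congr (_ * _).
exact: card_permT.
Qed.

Lemma crossing_wreath p (f : V * bool -> nat) i j :
  crossing (f \o wreath p) i j = crossing f (p.1 i) (p.1 j).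
Proof.
rewrite /crossing (inj_eq perm_inj) /side /= !wreathE.
case: eqP => //= _.
by case: (p.2 i); case: (p.2 j) => /=; do 4 case: (_ <= _).
Qed.

Definition allcross (f : V * bool -> nat) :=
  [forall i, forall j, (i != j) ==> crossing f i j].

Lemma allcross_mono (f f' : V * bool -> nat) :
  (forall d e, (f d <= f e) = (f' d <= f' e)) -> allcross f = allcross f'.
Proof.
move=> H; apply: eq_forallb => i; apply: eq_forallb => j.
by rewrite (crossing_mono H).
Qed.

End Wreath.

Section StandardCrossing.
Variable k : nat.

(** The only way for [k] chords on [2 k] points to cross pairwise: chord [i]
joins [i] to [i + k]. *)
Definition antipodal_pos (d : 'I_k * bool) : nat := d.1 + k * d.2.

Lemma antipodal_pos_inj : injective antipodal_pos.
Proof.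
move=> [i b] [j c]; rewrite /antipodal_pos /= => E.
have [-> /val_inj ->] : b = c /\ i = j :> nat; last by [].
have := ltn_ord i; have := ltn_ord j.
by case: b c E => [] [] /=; lia.
Qed.

Lemma allcross_antipodal p : allcross (antipodal_pos \o wreath p).
Proof.
apply/forallP => i; apply/forallP => j; apply/implyP => ij.
rewrite crossing_wreath /crossing (inj_eq perm_inj) ij /side /antipodal_pos /=.
have : p.1 i != p.1 j :> nat by rewrite (inj_eq val_inj) (inj_eq perm_inj).
rewrite muln0 muln1 !addn0; move: (p.1 i) (p.1 j) => [a ak] [b bk] /=.
by case: (ltngtP a b); lia.
Qed.

Lemma count_antipodal (lo hi : nat) : lo < hi -> hi < 2 * k ->
  \sum_d (lo < antipodal_pos d < hi) = hi - lo.+1.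
Proof.
move=> lh hk.
have -> : \sum_d (lo < antipodal_pos d < hi) = \sum_(0 <= t < 2 * k) (lo < t < hi).
  rewrite -(pair_bigA _ (fun (i : 'I_k) (b : bool) => nat_of_bool (lo < antipodal_pos (i, b) < hi))) /=.
  rewrite exchange_big big_bool /= /antipodal_pos /=.
  rewrite (@big_cat_nat _ _ _ k) //=; try lia.
  rewrite addnC; congr (_ + _).
    by rewrite big_mkord; apply: eq_bigr => i _; rewrite muln0 addn0.
  rewrite -[X in \sum_(X <= _ < _) _](add0n k) big_addn big_mkord.
  have -> : 2 * k - k = k by lia.
  by apply: eq_bigr => i _; rewrite muln1.
rewrite (@big_cat_nat _ _ _ lo.+1) //=; try lia.
rewrite (@big_cat_nat _ _ _ hi lo.+1) //=; try lia.
rewrite big_nat big1 ?add0n; last by lia.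
rewrite [X in _ + X]big_nat [X in _ + X]big1 ?addn0; last by lia.
rewrite big_nat (eq_bigr (fun=> 1)); last by lia.
by rewrite -big_nat sum_nat_const_nat muln1.
Qed.

(** Between the two ends of a chord lies exactly one end of each of the other
[k - 1] chords, so the ends are at distance [k]. *)
Lemma allcross_antipodalP (g : {perm 'I_k * bool}) :
  allcross (antipodal_pos \o g) -> exists p, g = wreath p.
Proof.
move=> gX; pose F := antipodal_pos \o g.
have FI : injective F by apply: inj_comp antipodal_pos_inj perm_inj.
have F2 d : F d < 2 * k.
  by rewrite /F /antipodal_pos /=; have := ltn_ord (g d).1; case: (g d).2 => /=; lia.
have dist i lo hi : F (i, lo) < F (i, hi) -> F (i, hi) = F (i, lo) + k.
  move=> lh.
  have : \sum_d (F (i, lo) < F d < F (i, hi)) = F (i, hi) - (F (i, lo)).+1.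
    rewrite -(count_antipodal lh) // [RHS](reindex_inj (@perm_inj _ g)).
    exact: eq_bigr.
  rewrite (eq_bigr (fun d => nat_of_bool (F (i, lo) < F (d.1, d.2) < F (i, hi))));
    last by case.
  rewrite -(pair_bigA _ (fun (j : 'I_k) (b : bool) =>
      nat_of_bool (F (i, lo) < F (j, b) < F (i, hi)))) /=.
  rewrite (bigD1 i) //= big1 => [|b _]; last first.
    have : hi != lo by apply: contraTneq lh => ->; rewrite ltnn.
    by case: b lo hi lh => [] [] [] //=; lia.
  rewrite (eq_bigr (fun=> 1)); last first.
    move=> j ji; have /forallP/(_ i)/forallP/(_ j) := gX.
    rewrite eq_sym ji /= /crossing eq_sym ji /= big_bool /= /side.
    have H b c : F (j, b) != F (i, c) by exact: dart_neq.
    have := H true true; have := H true false; have := H false true.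
    have := H false false; rewrite -/F.
    have : hi != lo by apply: contraTneq lh => ->; rewrite ltnn.
    by case: lo hi lh => [] [] //; rewrite /F /=; lia.
  rewrite sum1_card cardC1 card_ord add0n.
  move: (F (i, lo)) (F (i, hi)) lh => a b ab.
  by have : 0 < k by [apply: leq_ltn_trans (ltn_ord i)]; lia.
have half i : (g (i, true)).1 = (g (i, false)).1 /\
    (g (i, true)).2 = ~~ (g (i, false)).2.
  have := @dist i false true; have := @dist i true false.
  have : F (i, false) != F (i, true) by rewrite (inj_eq FI) xpair_eqE andbF.
  have [-> -> ] : F (i, false) = antipodal_pos (g (i, false)) /\
      F (i, true) = antipodal_pos (g (i, true)) by [].
  case: (g (i, false)) => a b; case: (g (i, true)) => c d.
  rewrite /antipodal_pos /= => N H1 H2.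
  have [/val_inj -> ->] : c = a :> nat /\ d = ~~ b; last by [].
  have := ltn_ord a; have := ltn_ord c.
  by case: b d N H1 H2 => [] [] /=; lia.
pose s i := (g (i, false)).1.
have gE i b : g (i, b) = (s i, b (+) (g (i, false)).2).
  case: b; last by rewrite addFb -surjective_pairing.
  by rewrite [LHS]surjective_pairing !(half i).1 (half i).2.
have sI : injective s.
  move=> i j ij; have : g (i, false) = g (j, (g (i, false)).2 (+) (g (j, false)).2).
    by rewrite [LHS]gE [RHS]gE ij -addbA addbb addbF.
  by move/perm_inj => [].
exists (perm sI, [ffun i => (g (i, false)).2]); apply/permP => -[i b].
by rewrite wreathE /= permE ffunE gE.
Qed.

(** Among the [(2 k)!] ways of attaching the labelled ends to given positions,
those with all chords crossing are the relabellings of the antipodal one. *)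
Lemma card_allcross (f : 'I_k * bool -> nat) : injective f ->
  #|[set g : {perm 'I_k * bool} | allcross (f \o g)]| = 2 ^ k * k`!.
Proof.
move=> fI; have [g0 g0P] := order_perm fI antipodal_pos_inj.
have -> : [set g : {perm 'I_k * bool} | allcross (f \o g)] =
    (fun g : {perm 'I_k * bool} => (g * g0^-1)%g) @^-1:
      [set g : {perm 'I_k * bool} | allcross (antipodal_pos \o g)].
  apply/finset.setP => g; rewrite !inE; apply: allcross_mono => d e /=.
  by rewrite -g0P !permM !permKV.
rewrite card_preimset; last exact: mulIg.
have -> : [set g : {perm 'I_k * bool} | allcross (antipodal_pos \o g)] =
    @wreath _ @: finset.setT.
  apply/finset.setP => g; rewrite inE; apply/idP/imsetP => [/allcross_antipodalP[p ->]|[p _ ->]].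
    by exists p.
  exact: allcross_antipodal.
by rewrite card_imset ?card_wreath ?card_ord //; exact: wreath_inj.
Qed.

End StandardCrossing.

(** * Concentration of the clique density of a random arrangement *)

Section SubsetAverage.
Variable V : finType.

Lemma perm_subset (A B : {set V}) : #|A| = #|B| -> exists s : {perm V}, s @: A = B.
Proof.
move=> AB; pose l (C : {set V}) := enum C ++ enum (~: C).
have lu C : uniq (l C).
  rewrite cat_uniq !enum_uniq andbT /=; apply/hasPn => x.
  by rewrite !mem_enum inE.
have lm C x : x \in l C by rewrite mem_cat !mem_enum inE orbN.
have ls C : size (l C) = #|V| by rewrite size_cat -!cardE cardsC.
pose f x := nth x (l B) (index x (l A)).
have iA x : index x (l A) < size (l B) by rewrite ls -(ls A) index_mem lm.
have fI : injective f.
  move=> x y; rewrite /f (set_nth_default x y) // => /eqP.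
  rewrite nth_uniq // => /eqP E.
  by rewrite -[x](nth_index x (lm A x)) E nth_index.
exists (perm fI); apply/eqP; rewrite eqEcard card_imset; last exact: perm_inj.
rewrite AB leqnn andbT; apply/fintype.subsetP => _ /imsetP[x xA ->].
have xi : index x (enum A) < size (enum B).
  by rewrite -cardE -AB cardE index_mem mem_enum.
rewrite permE /f /l index_cat mem_enum xA nth_cat xi -mem_enum.
exact: mem_nth.
Qed.

(** A uniform random permutation sends [B] to a uniform random set of the same
size. *)
Lemma sum_perm_image (B : {set V}) (Q : pred {set V}) :
  (\sum_(s : {perm V}) Q (s @: B)) * 'C(#|V|, #|B|) =
  (#|V|)`! * #|[set A : {set V} | (#|A| == #|B|) && Q A]|.
Proof.
pose c (A : {set V}) := \sum_(s : {perm V}) (s @: B == A : nat).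
have cE (A : {set V}) : #|A| = #|B| -> c A = c B.
  move=> /esym/perm_subset[t <-]; rewrite /c (reindex_inj (mulIg t)) /=.
  apply: eq_bigr => s _; congr nat_of_bool.
  have -> : (s * t)%g @: B = t @: (s @: B).
    by rewrite -imset_comp; apply: eq_imset => x; rewrite /= permM.
  by rewrite (inj_eq (imset_inj perm_inj)).
have main (Q' : pred {set V}) : \sum_(s : {perm V}) Q' (s @: B) =
    #|[set A : {set V} | (#|A| == #|B|) && Q' A]| * c B.
  rewrite -sum_nat_const.
  have -> : \sum_(A in [set A : {set V} | (#|A| == #|B|) && Q' A]) c B =
      \sum_(A in [set A : {set V} | (#|A| == #|B|) && Q' A]) c A.
    by apply: eq_bigr => A; rewrite inE => /andP[/eqP/cE -> _].
  rewrite exchange_big; apply: eq_bigr => s _ /=.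
  have sB : #|s @: B| = #|B| by rewrite card_imset //; exact: perm_inj.
  case: (boolP (Q' (s @: B))) => QB.
    rewrite (bigD1 (s @: B)) ?inE ?sB ?eqxx //= big1 // => A /andP[_].
    by rewrite eq_sym => /negPf ->.
  rewrite big1 // => A; rewrite inE => /andP[_ QA].
  by case: eqP QB => // ->; rewrite QA.
suff E : (#|V|)`! = 'C(#|V|, #|B|) * c B by rewrite main E; ring.
transitivity (\sum_(s : {perm V}) nat_of_bool (predT (s @: B))).
  by rewrite /= sum1_card card_permT.
rewrite main -card_draws; congr (_ * _).
by apply: eq_card => A; rewrite !inE andbT.
Qed.

End SubsetAverage.

Section Blocks.
Variables (n k : nat).
Implicit Types (h : 'I_k -> 'I_n) (f : 'I_n * bool -> nat).

Definition on_block h f (d : 'I_k * bool) : nat := f (h d.1, d.2).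

(** Permutes the ends of the chords of the block [h] according to [g], and fixes
all other ends. *)
Definition block_fun h (g : {perm 'I_k * bool}) (d : 'I_n * bool) : 'I_n * bool :=
  if [pick i | h i == d.1] is Some i then (h (g (i, d.2)).1, (g (i, d.2)).2) else d.

Lemma block_fun_in h g i b : injective h ->
  block_fun h g (h i, b) = (h (g (i, b)).1, (g (i, b)).2).
Proof.
move=> hI; rewrite /block_fun; case: pickP => [j /eqP/hI -> //|/(_ i)].
by rewrite eqxx.
Qed.

Lemma block_fun_out h g d : (forall i, h i != d.1) -> block_fun h g d = d.
Proof. by move=> H; rewrite /block_fun; case: pickP => // i; rewrite (negPf (H i)). Qed.

Lemma block_fun_inj h g : injective h -> injective (block_fun h g).
Proof.
move=> hI.
have gK (g1 g2 : {perm 'I_k * bool}) : cancel g1 g2 ->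
    cancel (block_fun h g1) (block_fun h g2).
  move=> K [v b]; case: (pickP (fun i => h i == v)) => [i /eqP <-|H].
    by rewrite block_fun_in // block_fun_in // -surjective_pairing K.
  by rewrite !block_fun_out // => i; rewrite H.
exact: can_inj (gK g g^-1%g (permK g)).
Qed.

Definition block_perm h (hI : injective h) g : {perm 'I_n * bool} :=
  perm (@block_fun_inj h g hI).

(** A uniform random [t] models a uniform labelled matching: end [d] sits at the
rank of [t d]. *)
Definition dart_pos (t : {perm 'I_n * bool}) (d : 'I_n * bool) : nat := enum_rank (t d).

Lemma dart_pos_inj t : injective (dart_pos t).
Proof. by move=> d e /val_inj/enum_rank_inj/perm_inj. Qed.

Definition block_cross h t := allcross (on_block h (dart_pos t)).

Lemma block_cross_self h (hI : injective h) g t :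
  block_cross h (block_perm hI g * t)%g =
  allcross (on_block h (dart_pos t) \o g).
Proof.
apply: allcross_mono => -[i b] [j c].
by rewrite /on_block /dart_pos /= !permM !permE !block_fun_in.
Qed.

Lemma block_cross_other h h' (hI : injective h) g t :
  (forall i j, h i != h' j) ->
  block_cross h' (block_perm hI g * t)%g = block_cross h' t.
Proof.
move=> hh'; apply: allcross_mono => -[i b] [j c].
have O l a : block_perm hI g (h' l, a) = (h' l, a).
  by rewrite permE block_fun_out // => l'; exact: hh'.
by rewrite /on_block /dart_pos /= !permM !O.
Qed.

Lemma block_cross_relabel h (s : {perm 'I_n}) t :
  block_cross h (wreath (s, [ffun=> false]) * t)%g = block_cross (s \o h) t.
Proof.
apply: allcross_mono => -[i b] [j c].
by rewrite /on_block /dart_pos /= !permM !wreathE !ffunE !addbF.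
Qed.

Lemma block_cross_clique h t : injective h ->
  block_cross h t = [forall x in h @: 'I_k, forall y in h @: 'I_k,
    (x != y) ==> crossing (dart_pos t) x y].
Proof.
move=> hI.
have E i j : crossing (on_block h (dart_pos t)) i j =
    crossing (dart_pos t) (h i) (h j) by rewrite /crossing (inj_eq hI).
apply/forallP/forall_inP => [H _ /imsetP[i _ ->]|H i].
  apply/forall_inP => _ /imsetP[j _ ->]; rewrite (inj_eq hI) -E.
  exact: (forallP (H i)).
apply/forallP => j; rewrite E -(inj_eq hI).
by apply: (forall_inP (H _ _)); apply: imset_f.
Qed.

Lemma sum_block_cross h t : injective h ->
  (\sum_(s : {perm 'I_n}) block_cross h (wreath (s, [ffun=> false]) * t)%g)
    * 'C(n, k) = n`! * n_cliques (crossing (dart_pos t)) k.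
Proof.
move=> hI; pose Q (A : {set 'I_n}) := [forall x in A, forall y in A,
  (x != y) ==> crossing (dart_pos t) x y].
have hk : #|h @: 'I_k| = k by rewrite card_imset // card_ord.
have := sum_perm_image (h @: 'I_k) Q; rewrite card_ord hk => <-.
congr (_ * _); apply: eq_bigr => s _; congr nat_of_bool.
rewrite block_cross_relabel block_cross_clique; last exact: inj_comp perm_inj hI.
by rewrite imset_comp.
Qed.

End Blocks.

Section Concentration.
Variable R : realType.
Local Open Scope ring_scope.

Definition cross_prob k : R := (2 ^ k * k`!)%:R / ((2 * k)`!)%:R.

Lemma card_perm_dart k : #|{perm 'I_k * bool}| = ((2 * k)`!)%N.
Proof.
by rewrite card_permT card_prod card_ord card_bool mulnC.
Qed.

Lemma sum_bool_phi (T : finType) (P : pred T) (phi : bool -> R) :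
  \sum_(t : T) phi (P t) = #|P|%:R * phi true + (#|T|%:R - #|P|%:R) * phi false.
Proof.
rewrite (bigID P) /= (eq_bigr (fun=> phi true)) => [|t ->//].
rewrite [X in _ + X](eq_bigr (fun=> phi false)) => [|t /negPf->//].
rewrite !sumr_const !mulr_natl; congr (_ + _).
rewrite -(cardC P) natrD addrC addKr mulr_natl; congr (_ *+ _).
Qed.

(** Disjoint blocks of chords cross independently.  Rearranging the ends inside
the last block by a uniform [g] does not affect the other blocks, while the last
one becomes crossing for exactly [2 ^ k * k!] of the [(2 k)!] choices of [g],
whatever the other ends are. *)
Lemma sum_blocks_prod n k (h : nat -> 'I_k -> 'I_n) (phi : bool -> R) M :
  (forall j, (j < M)%N -> injective (h j)) ->
  (forall j l i i', (j < M)%N -> (l < M)%N -> j != l -> h j i != h l i') ->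
  \sum_(t : {perm 'I_n * bool}) \prod_(j < M) phi (block_cross (h j) t) =
  ((2 * n)`!)%:R *
    (cross_prob k * phi true + (1 - cross_prob k) * phi false) ^+ M.
Proof.
elim: M => [|M IH] hI hD.
  under eq_bigr do rewrite big_ord0.
  by rewrite sumr_const card_perm_dart expr0 mulr1.
have F0 : ((2 * k)`!)%:R != 0 :> R by rewrite pnatr_eq0 -lt0n fact_gt0.
have hM : injective (h M) by apply: hI.
rewrite exprSr mulrA -IH; first last.
- by move=> j l i i' jM lM; apply: hD; lia.
- by move=> j jM; apply: hI; lia.
apply: (mulfI F0); rewrite mulr_natl -card_perm_dart -sumr_const.
under eq_bigr => g _ do rewrite (reindex_inj (mulgI (block_perm hM g))).
rewrite exchange_big mulrCA mulr_suml; apply: eq_bigr => t _ /=.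
under eq_bigr => g _.
  rewrite big_ord_recr /= block_cross_self.
  under eq_bigr => j _.
    rewrite block_cross_other; last first.
      by move=> i i'; apply: hD; have := ltn_ord j; lia.
    over.
  over.
rewrite -mulr_sumr sum_bool_phi; congr (_ * _).
have -> : #|fun g : {perm 'I_k * bool} => allcross (on_block (h M) (dart_pos t) \o g)|
    = (2 ^ k * k`!)%N.
  rewrite -(@card_allcross k (on_block (h M) (dart_pos t))); last first.
    by move=> [i b] [j c] /dart_pos_inj[/hM -> ->].
  by rewrite cardsE.
by rewrite card_perm_dart /cross_prob; field.
Qed.

Lemma cross_prob_ge0 k : 0 <= cross_prob k.
Proof. by rewrite divr_ge0. Qed.

Lemma cross_prob_le1 k : cross_prob k <= 1.
Proof.
rewrite /cross_prob ler_pdivrMr ?mul1r ?ler_nat ?ltr0n ?fact_gt0 //.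
rewrite -card_perm_dart -(@card_allcross k (@antipodal_pos k)) ?max_card //.
exact: antipodal_pos_inj.
Qed.

(** From expR (- x) >= 1 - x and (1 - x)(1 + x + 2 x ^ 2) >= 1. *)
Lemma expR_le_quad (x : R) : x <= 2^-1 -> expR x <= 1 + x + 2 * x ^+ 2.
Proof.
move=> x2; have := expR_ge1Dx (- x); have := expR_gt0 x; have := expRxMexpNx_1 x.
have : 1 + x + 2 * x ^+ 2 > 0 by nra.
move: (expR x) (expR (- x)) => a b q0 ab a0 bx.
have h1 : a * (1 - x) <= 1 by rewrite -[leRHS]ab ler_wpM2l // ltW.
have h2 : 1 <= (1 - x) * (1 + x + 2 * x ^+ 2) by nra.
have h3 : a * (1 - x) * (1 + x + 2 * x ^+ 2) <= 1 + x + 2 * x ^+ 2.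
  by rewrite -[leRHS]mul1r ler_wpM2r // ltW.
apply: le_trans h3; rewrite -mulrA -[leLHS]mulr1 ler_wpM2l //; exact: ltW.
Qed.

Lemma bernoulli_mgf (p l : R) : 0 <= p <= 1 -> `|l| <= 2^-1 ->
  p * expR (l * (1 - p)) + (1 - p) * expR (l * (0 - p)) <= expR (2 * l ^+ 2).
Proof.
move=> /andP[p0 p1]; rewrite ler_norml => /andP[l1 l2].
have A : expR (l * (1 - p)) <= 1 + l * (1 - p) + 2 * (l * (1 - p)) ^+ 2.
  by apply: expR_le_quad; nra.
have B : expR (l * (0 - p)) <= 1 + l * (0 - p) + 2 * (l * (0 - p)) ^+ 2.
  by apply: expR_le_quad; nra.
apply: le_trans (expR_ge1Dx _).
have := ler_wpM2l p0 A; have := @ler_wpM2l _ (1 - p) _ _ _ B.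
rewrite subr_ge0 => /(_ p1) b a; apply: le_trans (lerD a b) _.
have -> : p * (1 + l * (1 - p) + 2 * (l * (1 - p)) ^+ 2) +
  (1 - p) * (1 + l * (0 - p) + 2 * (l * (0 - p)) ^+ 2) =
  1 + 2 * l ^+ 2 * (p * (1 - p)) by ring.
have P1 : p * (1 - p) <= 1 by nra.
by rewrite lerD2l -[leRHS]mulr1 ler_wpM2l // mulr_ge0 // sqr_ge0.
Qed.

(** Sum the tangent line inequality of the exponential at the mean. *)
Lemma expR_jensen (I : finType) (F : I -> R) : (0 < #|I|)%N ->
  #|I|%:R * expR ((\sum_i F i) / #|I|%:R) <= \sum_i expR (F i).
Proof.
move=> I0; have N0 : #|I|%:R != 0 :> R by rewrite pnatr_eq0 -lt0n.
set m := _ / _.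
have : \sum_i expR m * (1 + (F i - m)) <= \sum_i expR (F i).
  apply: ler_sum => i _;
  have -> : expR (F i) = expR m * expR (F i - m) by rewrite -expRD addrC subrK.
  by apply: ler_wpM2l; [exact: expR_ge0|exact: expR_ge1Dx].
apply: le_trans; rewrite -mulr_sumr big_split /= sumrB !sumr_const.
by rewrite -[m *+ _]mulr_natr /m divfK // subrr addr0 mulrC.
Qed.

Definition clique_density n k (t : {perm 'I_n * bool}) : R :=
  (n_cliques (crossing (dart_pos t)) k)%:R / 'C(n, k)%:R.

(** Hoeffding's method for U-statistics: the clique density is the average, over
relabellings of the chords, of the proportion of crossing blocks among [M]
disjoint blocks of size [k].  By convexity its exponential moments are bounded
by those of a sum of independent variables. *)
Section Chernoff.
Variables (n k : nat).
Hypotheses (k0 : (0 < k)%N) (kn : (k <= n.+1)%N).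

(** Only the values of [j] with [(j + 1) * k <= n + 1] are used, for which the
argument of [inord] is in range. *)
Definition nth_block (j : nat) (i : 'I_k) : 'I_n.+1 := inord (j * k + i).

Let M := (n.+1 %/ k)%N.

Lemma nth_block_val j (i : 'I_k) : (j < M)%N ->
  nth_block j i = (j * k + i)%N :> nat.
Proof.
move=> jM; rewrite /nth_block inordK //.
apply: (@leq_trans (j.+1 * k)); first by rewrite mulSn; have := ltn_ord i; lia.
by apply: leq_trans (leq_divM n.+1 k); rewrite leq_mul2r jM orbT.
Qed.

Lemma nth_block_inj j : (j < M)%N -> injective (nth_block j).
Proof.
move=> jM i i' /(congr1 val) /=; rewrite !nth_block_val // => /addnI.
exact: val_inj.
Qed.

Lemma nth_block_disjoint j l i i' : (j < M)%N -> (l < M)%N -> j != l ->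
  nth_block j i != nth_block l i'.
Proof.
move=> jM lM; apply: contraNneq => /(congr1 val) /=; rewrite !nth_block_val //.
move=> /(congr1 (divn^~ k)); rewrite !divnMDl // !divn_small ?ltn_ord //.
by rewrite !addn0 => ->.
Qed.

Definition block_sum t : R := \sum_(j < M) (block_cross (nth_block j) t)%:R.

Lemma sum_block_sum t : \sum_(s : {perm 'I_n.+1})
    block_sum (wreath (s, [ffun=> false]) * t)%g =
  (n.+1)`!%:R * (M%:R * clique_density k t).
Proof.
have C0 : 'C(n.+1, k)%:R != 0 :> R by rewrite pnatr_eq0 -lt0n bin_gt0.
rewrite exchange_big (eq_bigr (fun=> n.+1`!%:R * clique_density k t)).
  by rewrite sumr_const card_ord -[LHS]mulr_natl mulrCA.
move=> j _; rewrite -natr_sum; apply: (mulIf C0).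
rewrite -natrM sum_block_cross; last exact: nth_block_inj.
by rewrite /clique_density natrM -mulrA divfK.
Qed.

Lemma clique_density_mgf (l : R) : `|l| <= 2^-1 ->
  \sum_(t : {perm 'I_n.+1 * bool})
     expR (l * M%:R * (clique_density k t - cross_prob k)) <=
  ((2 * n.+1)`!)%:R * expR (2 * l ^+ 2 * M%:R).
Proof.
move=> l2; set p := cross_prob k.
have cS : #|{perm 'I_n.+1}| = n.+1`! by rewrite card_permT card_ord.
have f0 : 0 < n.+1`!%:R :> R by rewrite ltr0n fact_gt0.
pose X t := l * (block_sum t - M%:R * p).
have J t : n.+1`!%:R * expR (l * M%:R * (clique_density k t - p)) <=
    \sum_(s : {perm 'I_n.+1}) expR (X (wreath (s, [ffun=> false]) * t)%g).
  have S0 : (0 < #|{perm 'I_n.+1}|)%N by rewrite cS fact_gt0.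
  rewrite -cS; apply: le_trans
    (expR_jensen (fun s => X (wreath (s, [ffun=> false]) * t)%g) S0).
  rewrite ler_wpM2l // ler_expR -mulr_sumr sumrB sum_block_sum sumr_const cS.
  rewrite le_eqVlt; apply/orP; left; apply/eqP.
  by rewrite -[_ *+ _]mulr_natl; field; rewrite gt_eqF.
rewrite -(ler_pM2l f0) mulr_sumr.
apply: le_trans (ler_sum _ (fun t _ => J t)) _.
rewrite exchange_big /=.
have -> : \sum_(s : {perm 'I_n.+1}) \sum_(t : {perm 'I_n.+1 * bool})
    expR (X (wreath (s, [ffun=> false]) * t)%g) =
    n.+1`!%:R * \sum_(t : {perm 'I_n.+1 * bool}) expR (X t).
  rewrite -cS mulr_natl -sumr_const; apply: eq_bigr => s _.
  by rewrite [RHS](reindex_inj (mulgI (wreath (s, [ffun=> false])))).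
rewrite ler_pM2l //.
pose phi (b : bool) := expR (l * (b%:R - p)).
have -> : \sum_(t : {perm 'I_n.+1 * bool}) expR (X t) =
  \sum_(t : {perm 'I_n.+1 * bool}) \prod_(j < M)
     phi (block_cross (nth_block j) t).
  apply: eq_bigr => t _; rewrite -expR_sum /=; congr expR.
  by rewrite -mulr_sumr sumrB sumr_const card_ord /X /block_sum mulr_natl.
rewrite (sum_blocks_prod phi nth_block_inj nth_block_disjoint).
rewrite ler_wpM2l // expRM_natr lerXn2r ?nnegrE ?expR_ge0 //.
  by rewrite addr_ge0 ?mulr_ge0 ?expR_ge0 ?subr_ge0 ?cross_prob_ge0 ?cross_prob_le1.
by apply: bernoulli_mgf; rewrite ?cross_prob_ge0 ?cross_prob_le1.
Qed.

Lemma card_far_chernoff (P : pred {perm 'I_n.+1 * bool}) (l c : R) :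
  `|l| <= 2^-1 ->
  (forall t, P t -> c <= l * (clique_density k t - cross_prob k)) ->
  #|P|%:R <= ((2 * n.+1)`!)%:R * expR ((2 * l ^+ 2 - c) * M%:R).
Proof.
move=> l2 Pc; have := clique_density_mgf l2.
have : #|P|%:R * expR (c * M%:R) <= \sum_(t : {perm 'I_n.+1 * bool})
     expR (l * M%:R * (clique_density k t - cross_prob k)).
  rewrite mulr_natl -sumr_const big_mkcond /=; apply: ler_sum => t _.
  case: ifP => [/Pc ct|_]; last exact: expR_ge0.
  by rewrite ler_expR mulrAC ler_wpM2r.
move=> /le_trans H /H; rewrite -ler_pdivlMr ?expR_gt0 //.
by rewrite -[X in _ <= X -> _]mulrA -expRN -expRD mulrBl.
Qed.

(** The exponent 2 l ^ 2 - l eps is optimal at l = eps / 4. *)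
Lemma card_far (eps : R) : 0 < eps <= 1 ->
  #|[set t : {perm 'I_n.+1 * bool} |
      eps < `|clique_density k t - cross_prob k|]%SET|%:R <=
  2 * ((2 * n.+1)`!)%:R * expR (- (eps ^+ 2 / 8) * M%:R).
Proof.
move=> /andP[e0 e1].
have l4 : `|eps / 4| <= 2^-1 by rewrite ger0_norm; lra.
have E : - (eps ^+ 2 / 8) = 2 * (eps / 4) ^+ 2 - eps ^+ 2 / 4 by field.
pose P1 (t : {perm 'I_n.+1 * bool}) := eps < clique_density k t - cross_prob k.
pose P2 (t : {perm 'I_n.+1 * bool}) := clique_density k t - cross_prob k < - eps.
have H1 := @card_far_chernoff P1 (eps / 4) (eps ^+ 2 / 4) l4.
have H2 := @card_far_chernoff P2 (- (eps / 4)) (eps ^+ 2 / 4).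
rewrite normrN in H2; have {}H2 := H2 l4.
have {}H1 := H1 ltac:(by rewrite /P1 => t; nra).
have {}H2 := H2 ltac:(by rewrite /P2 => t; nra).
rewrite sqrrN -E in H2; rewrite -E in H1.
rewrite -[2]/(1 + 1) 2!mulrDl !mul1r; apply: le_trans (lerD H1 H2).
rewrite -natrD ler_nat -(cardsE P1) -(cardsE P2); apply: leq_trans (leq_card_setU _ _).
apply: subset_leq_card; apply/fintype.subsetP => t; rewrite !inE /P1 /P2.
by rewrite lter_normr ltrNr orbC.
Qed.

End Chernoff.
End Concentration.

(** * Chords of the circle intersect iff their ends interleave *)

Section Geometry.
Variable R : realType.
Local Open Scope ring_scope.

(** Twice the signed area of the triangle [p q r]. *)
Definition orient (p q r : R * R) : R :=
  (q.1 - p.1) * (r.2 - p.2) - (q.2 - p.2) * (r.1 - p.1).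

Lemma combE (p q : R * R) (t : R) : (1 - t) *: p + t *: q =
  ((1 - t) * p.1 + t * q.1, (1 - t) * p.2 + t * q.2).
Proof. by []. Qed.

Lemma orient_segment (p q r s : R * R) (t : R) :
  orient p q ((1 - t) *: r + t *: s) = (1 - t) * orient p q r + t * orient p q s.
Proof. by rewrite combE /orient /=; ring. Qed.

(** Both ends of the second segment lie strictly on one side of the line through
the first. *)
Lemma segment_disjoint (p q r s : R * R) :
  0 < orient p q r * orient p q s ->
  ~ exists z, segment p q z /\ segment r s z.
Proof.
move=> H [z [[t _ <-] [u /=]]]; rewrite in_itv /= => /andP[u0 u1] E.
have := congr1 (orient p q) E; rewrite !orient_segment.
have -> : orient p q p = 0 by rewrite /orient; ring.
have -> : orient p q q = 0 by rewrite /orient; ring.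
rewrite !mulr0 addr0; move: H; set a := orient p q r; set b := orient p q s.
move=> H /eqP; apply/negP.
have [a0|a0] := ltrP 0 a.
  have b0 : 0 < b by nra.
  by rewrite gt_eqF //; nra.
have b0 : b < 0 by nra.
have {}a0 : a < 0 by nra.
by rewrite lt_eqF //; nra.
Qed.

(** Each segment has its ends on both sides of the line through the other; the
parameters of the intersection point of the two lines are given by Cramer's
rule. *)
Lemma segment_meet (p q r s : R * R) :
  orient p q r * orient p q s < 0 -> orient r s p * orient r s q < 0 ->
  exists z, segment p q z /\ segment r s z.
Proof.
have par (a b : R) : a * b < 0 -> [/\ a - b != 0, 0 <= a / (a - b) & a / (a - b) <= 1].
  move=> ab; have [a0|a0] := ltrP 0 a.
    have b0 : b < 0 by nra.
    have c0 : 0 < a - b by lra.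
    split; [by rewrite gt_eqF|by rewrite divr_ge0 ?ltW|].
    by rewrite ler_pdivrMr //; lra.
  have b0 : 0 < b by nra.
  have c0 : 0 < b - a by lra.
  have -> : a / (a - b) = (- a) / (b - a) by rewrite -opprB invrN mulrN mulNr.
  split; [by rewrite lt_eqF //; lra|by apply: divr_ge0; [rewrite oppr_ge0|exact: ltW]|].
  by rewrite ler_pdivrMr //; lra.
move=> /par[h1 h2 h3] /par[h4 h5 h6].
set u := orient p q r / _ in h2 h3; set t := orient r s p / _ in h5 h6.
exists ((1 - t) *: p + t *: q); split.
  by exists t => //=; rewrite in_itv /= h5 h6.
exists u; first by rewrite /= in_itv /= h2 h3.
move: h1 h4; rewrite /u /t {u t h2 h3 h5 h6} /orient => h1 h4.
case: p q r s h1 h4 => [p1 p2] [q1 q2] [r1 r2] [s1 s2] /= h1 h4.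
by rewrite !combE /=; congr pair; field; apply/andP.
Qed.

Variable n : nat.
Local Notation pt := (@circle_point R n).

(** Rows (w, x, y) are the points of the circle in homogeneous half-angle
coordinates: the determinant of three quadratic forms on a conic is a product
of Vandermonde type. *)
Lemma half_angle_det (a b c a' b' c' : R) :
  let x u v := u ^+ 2 - v ^+ 2 in let y u v := 2 * v * u in
  let w u v := u ^+ 2 + v ^+ 2 in
  w a a' * (x b b' * y c c' - y b b' * x c c')
  - w b b' * (x a a' * y c c' - y a a' * x c c')
  + w c c' * (x a a' * y b b' - y a a' * x b b') =
  4 * (b' * a - b * a') * (c' * b - c * b') * (c' * a - c * a').
Proof. by move=> x y w; rewrite /x /y /w; ring. Qed.

(** With half-angles ti < tj < tk in (0, pi], twice the signed area is
4 sin (tj - ti) sin (tk - tj) sin (tk - ti). *)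
Lemma orient_gt0 (i j k : 'I_(2 * n)) : (i < j)%N -> (j < k)%N ->
  0 < orient (pt i) (pt j) (pt k).
Proof.
move=> ij jk; have n0 : 0 < (2 * n)%:R :> R by rewrite ltr0n; have := ltn_ord i; lia.
pose t (i : 'I_(2 * n)) : R := pi * i.+1%:R / (2 * n)%:R.
have ptE l : pt l = (cos (t l) ^+ 2 - sin (t l) ^+ 2, 2 * sin (t l) * cos (t l)).
  have E : 2 * pi * l.+1%:R / (2 * n)%:R = t l + t l.
    by rewrite /t; move: (2 * n)%:R n0 => N N0; field; rewrite gt_eqF.
  by rewrite /circle_point E sinD cosD; congr pair; ring.
have dt (a b : 'I_(2 * n)) : (a < b)%N -> 0 < sin (t b - t a).
  move=> ab; have -> : t b - t a = pi * ((b - a)%N%:R / (2 * n)%:R).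
    rewrite /t; move: (2 * n)%:R n0 => N N0.
    rewrite natrB ?(ltnW ab) // -[b.+1]addn1 -[a.+1]addn1 !natrD; field; by rewrite gt_eqF.
  apply: sin_gt0_pi.
  have q0 : 0 < (b - a)%N%:R / (2 * n)%:R :> R by rewrite divr_gt0 // ltr0n subn_gt0.
  rewrite mulr_gt0 ?pi_gt0 //=.
  rewrite -[ltRHS]mulr1 ltr_pM2l ?pi_gt0 // ltr_pdivrMr // mul1r ltr_nat.
  by have := ltn_ord b; lia.
have -> : orient (pt i) (pt j) (pt k) =
  4 * sin (t j - t i) * sin (t k - t j) * sin (t k - t i).
  rewrite !sinB -half_angle_det !cos2Dsin2 !ptE /orient /=; ring.
by rewrite !mulr_gt0 // dt //; lia.
Qed.

Lemma orient_sign (i j k : 'I_(2 * n)) : i != j -> j != k -> i != k ->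
  (0 < orient (pt i) (pt j) (pt k) /\ (i < j)%N (+) (j < k)%N (+) (i < k)%N) \/
  (orient (pt i) (pt j) (pt k) < 0 /\ ~~ ((i < j)%N (+) (j < k)%N (+) (i < k)%N)).
Proof.
have cyc p q r : orient p q r = orient q r p by rewrite /orient; ring.
have swp p q r : orient p q r = - orient q p r by rewrite /orient; ring.
rewrite -!(inj_eq val_inj) /=.
case: (ltngtP i j) => // ij _; case: (ltngtP j k) => // jk _;
  case: (ltngtP i k) => // ik _ /=; try lia; [left|right|left|right|left|right]; split => //.
- exact: orient_gt0.
- by rewrite swp oppr_lt0 cyc orient_gt0.
- by rewrite -cyc orient_gt0.
- by rewrite swp oppr_lt0 orient_gt0.
- by rewrite cyc orient_gt0.
- by rewrite cyc swp oppr_lt0 orient_gt0.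
Qed.

Lemma segments_meet (a b c d : 'I_(2 * n)) : uniq [:: a; b; c; d] ->
  (exists z, segment (pt a) (pt b) z /\ segment (pt c) (pt d) z) <->
  ((c <= a)%N (+) (d <= a)%N) (+) ((c <= b)%N (+) (d <= b)%N).
Proof.
rewrite /= !inE !negb_or !andbT => /and3P[/and3P[ab ac ad] /andP[bc bd] cd].
have flip (x y : 'I_(2 * n)) : x != y -> (y < x)%N = ~~ (x < y)%N.
  by rewrite -(inj_eq val_inj) /=; lia.
have le (x y : 'I_(2 * n)) : (x <= y)%N = ~~ (y < x)%N by rewrite leqNgt.
have [ba ca da] : [/\ b != a, c != a & d != a] by rewrite ![_ == a]eq_sym.
have [cb db dc] : [/\ c != b, d != b & d != c].
  by rewrite ![_ == b]eq_sym [d == c]eq_sym.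
rewrite !le; split.
  move=> meet; apply/negP => /negP npar; move: meet; apply: segment_disjoint.
  move: npar.
  case: (orient_sign ab bc ac) => -[s1 p1]; case: (orient_sign ab bd ad) => -[s2 p2];
    try (by move=> _; nra).
  - by move: p1 p2; do 5 case: (_ < _)%N.
  - by move: p1 p2; do 5 case: (_ < _)%N.
move=> par; apply: segment_meet.
  move: par.
  case: (orient_sign ab bc ac) => -[s1 p1]; case: (orient_sign ab bd ad) => -[s2 p2];
    try (by move=> _; nra); by move: p1 p2; do 5 case: (_ < _)%N.
move: par; rewrite (flip c a) // (flip d a) // (flip c b) // (flip d b) //.
case: (orient_sign cd da ca) => -[s1 p1]; case: (orient_sign cd db cb) => -[s2 p2];
    try (by move=> _; nra); by move: p1 p2; do 5 case: (_ < _)%N.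
Qed.

End Geometry.

(** * From unlabelled circle graphs to labelled arrangements *)

Lemma isomorphic_perm (V : finType) (e e' : rel V) : isomorphic e e' ->
  exists s : {perm V}, forall x y, e' (s x) (s y) = e x y.
Proof.
case/asboolP => h /bij_inj hI hE; exists (perm hI) => x y.
by rewrite !permE.
Qed.

Lemma isomorphic_id (V : finType) (e e' : rel V) : e =2 e' -> isomorphic e e'.
Proof. by move=> H; apply/asboolP; exists id; [exists id|move=> x y; rewrite H]. Qed.

Section Labelling.
Variables (R : realType) (n : nat).
Implicit Types (m : {ffun 'I_(2 * n) -> 'I_(2 * n)}) (s : 'I_n * bool -> 'I_(2 * n)).

Lemma labelling_surj s : injective s -> forall x, exists d, s d = x.
Proof.
move=> sI; have [q sq qs] : bijective s.
  by apply: inj_card_bij => //; rewrite card_prod !card_ord card_bool mulnC.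
by move=> x; exists (q x).
Qed.

Lemma isomorphic_chord_adj m s : injective s ->
  (forall i b, m (s (i, b)) = s (i, ~~ b)) ->
  isomorphic (crossing (fun d => s d : nat)) (@chord_adj R n m).
Proof.
move=> sI ms; pose A i := [set s (i, false); s (i, true)]%SET.
have AP i : A i \in chords m by apply/imsetP; exists (s (i, false)); rewrite ?ms.
pose h i : chord m := exist _ (A i) (AP i).
have hI : injective h.
  move=> i j [E]; have : s (i, false) \in A j by rewrite -E !inE eqxx.
  by rewrite !inE => /orP[]/eqP/sI[].
have hS (B : chord m) : exists i, h i = B.
  case: B => B BP; case/imsetP: (BP) => x _ Bx.
  have [[i b] sx] := labelling_surj sI x; exists i; apply: val_inj => /=.
  by rewrite Bx -sx ms /A; case: b {sx} => //=; rewrite finset.setUC.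
have hB : bijective h.
  apply: inj_card_bij => //; rewrite -(card_codom hI); apply: eq_leq.
  by apply: eq_card => B; apply/esym/codomP; have [i <-] := hS B; exists i.
apply/asboolP; exists h => // i j; rewrite /chord_adj (inj_eq hI) /crossing.
case: (eqVneq i j) => //= ij.
have segC (p q z : R * R) : segment p q z -> segment q p z.
  case=> t /=; rewrite in_itv /= => /andP[t0 t1] <-; exists (1 - t)%R.
    by rewrite /= in_itv /=; lra.
  by rewrite opprB addrCA subrr addr0 addrC.
have chordE l (z : R * R) : chord_segment R (h l) z <->
    segment (circle_point R (s (l, false))) (circle_point R (s (l, true))) z.
  split; last by exists (s (l, false)); rewrite /= ?inE ?eqxx ?ms.
  by case=> x; rewrite !inE => /orP[]/eqP ->; rewrite ms //=; exact: segC.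
have U : uniq [:: s (i, false); s (i, true); s (j, false); s (j, true)].
  by rewrite /= !inE !(inj_eq sI) !xpair_eqE !(negPf ij) /= !andbF.
have [G1 G2] := @segments_meet R n _ _ _ _ U.
apply/asboolP/idP => [[z [/chordE z1 /chordE z2]]|/G2[z [z1 z2]]].
  by apply: G1; exists z.
by exists z; split; apply/chordE.
Qed.

(** Chord number [i] is the one starting at the [i]-th point that is smaller
than its partner. *)
Lemma matching_labelling m : is_matching m ->
  exists2 s : 'I_n * bool -> 'I_(2 * n), injective s & forall i b, m (s (i, b)) = s (i, ~~ b).
Proof.
move=> /forallP mP; have mm x : m (m x) = x by case/andP: (mP x) => /eqP.
have mx x : m x != x by case/andP: (mP x).
have mI : injective m by apply: can_inj mm.
pose S := [set x : 'I_(2 * n) | (x < m x)%N]%SET.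
have cS : #|S| = n.
  have : #|S| = #|~: S|%SET.
    rewrite -(card_imset _ mI); apply: eq_card => x; rewrite !inE -leqNgt.
    apply/imsetP/idP => [[y]|xS]; first by rewrite inE => yS ->; rewrite mm ltnW.
    by exists (m x); rewrite ?inE mm // ltn_neqAle xS (inj_eq val_inj) mx.
  by have := cardsC S; rewrite card_ord; lia.
pose a (i : 'I_n) : 'I_(2 * n) := enum_val (cast_ord (esym cS) i).
have aS i : (a i < m (a i))%N.
  by have := enum_valP (cast_ord (esym cS) i); rewrite inE.
have aI : injective a by move=> i j /enum_val_inj/cast_ord_inj.
have aN i j : a i != m (a j).
  by apply/eqP => E; have := aS i; have := aS j; rewrite E mm; lia.
exists (fun d => if d.2 then m (a d.1) else a d.1); last first.
  by move=> i [] /=; rewrite ?mm.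
move=> [i []] [j []] /=.
- by move=> /mI/aI ->.
- by move/esym/eqP; rewrite (negPf (aN _ _)).
- by move/eqP; rewrite (negPf (aN _ _)).
- by move=> /aI ->.
Qed.

Lemma labelling_matching s : injective s ->
  exists2 m : {ffun 'I_(2 * n) -> 'I_(2 * n)}, is_matching m & forall i b, m (s (i, b)) = s (i, ~~ b).
Proof.
move=> sI; have [q sq qs] : bijective s.
  by apply: inj_card_bij => //; rewrite card_prod !card_ord card_bool mulnC.
exists [ffun x => s ((q x).1, ~~ (q x).2)].
  apply/forallP => x; rewrite !ffunE sq /= negbK -surjective_pairing qs eqxx /=.
  rewrite -{3}(qs x) (inj_eq sI); case: (q x) => i b.
  by rewrite xpair_eqE eqxx /=; case: b.
by move=> i b; rewrite ffunE sq.
Qed.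

Lemma circle_graph_labelling (G : ugraph n) : is_circle_graph R G ->
  exists t : {perm 'I_n * bool}, isomorphic (uadj G) (crossing (dart_pos t)).
Proof.
case/existsP => m /andP[/matching_labelling[s sI ms] iso].
have sI' : injective (fun d => s d : nat) by move=> d e /val_inj/sI.
have [t tP] := order_perm (@dart_pos_inj n 1%g) sI'.
exists t; apply: isomorphic_trans iso _; rewrite isomorphic_sym.
apply: isomorphic_trans (isomorphic_chord_adj sI ms).
apply: isomorphic_id; apply: crossing_mono => d e; rewrite -tP /dart_pos.
by rewrite !perm1.
Qed.

Lemma crossing_circle_graph (G : ugraph n) (f : 'I_n * bool -> nat) :
  injective f -> isomorphic (uadj G) (crossing f) -> is_circle_graph R G.
Proof.
move=> /rank_exists[r rI rf] iso.
have E : #|{: 'I_n * bool}| = (2 * n)%N.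
  by rewrite card_prod card_ord card_bool mulnC.
pose s d := cast_ord E (r d).
have sI : injective s by move=> d e /cast_ord_inj/rI.
have [m mm ms] := labelling_matching sI.
apply/existsP; exists m; rewrite mm; apply: isomorphic_trans iso _.
apply: isomorphic_trans (isomorphic_chord_adj sI ms).
by apply: isomorphic_id; apply: crossing_mono => d e; rewrite -rf.
Qed.

Lemma ugraph_eq (G H : ugraph n) : isomorphic (uadj G) (uadj H) -> G = H.
Proof. by move=> GH; rewrite -(reprK G) -(reprK H); apply/eqmodP. Qed.

(** An unlabelled graph has at most [n!] labelled versions. *)
Lemma card_prime_circle_ub : #|prime_circle n| <= #|{: circle_graph R n}| * n`!.
Proof.
pose rl (e : rel 'I_n) (s : {perm 'I_n}) : {ffun 'I_n * 'I_n -> bool} :=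
  [ffun p => e (s p.1) (s p.2)].
have sub : prime_circle n \subset [set rl (uadj (val p.1)) p.2 |
   p : circle_graph R n * {perm 'I_n}]%SET.
  apply/fintype.subsetP => g /prime_circleP[_ [f fI gf]].
  have gs : is_sgraph g.
    apply/andP; split; apply/forallP => x; first by rewrite gf /crossing eqxx.
    by apply/forallP => y; rewrite !gf crossing_sym.
  pose g0 : sgraph n := exist _ g gs.
  have iso := uadj_pi g0.
  have Gc : is_circle_graph R (\pi_(ugraph n) g0)%qT.
    apply: crossing_circle_graph fI _; apply: isomorphic_trans iso _.
    by apply: isomorphic_id => x y; rewrite /adj /= gf.
  have [s sP] := isomorphic_perm (etrans (isomorphic_sym _ _) iso).
  apply/imsetP.
  pose G1 : circle_graph R n :=
    exist (fun G => is_circle_graph R G) _ Gc.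
  exists (G1, s) => //; apply/ffunP => -[x y].
  by rewrite ffunE /= sP.
apply: leq_trans (subset_leq_card sub) _; apply: leq_trans (leq_imset_card _ _) _.
by rewrite card_prod card_permT card_ord.
Qed.

(** Every circle graph comes from a matching, hence from at least the
[2 ^ n * n!] labelled arrangements obtained by relabelling its chords, and these
sets are disjoint for distinct graphs. *)
Lemma card_circle_graph_prop (Q : rel 'I_n -> bool) :
  (forall e e', isomorphic e e' -> Q e = Q e') ->
  #|[set G : circle_graph R n | Q (uadj (val G))]%SET| * (2 ^ n * n`!) <=
  #|[set t : {perm 'I_n * bool} | Q (crossing (dart_pos t))]%SET|.
Proof.
move=> Qiso.
have /choice[t tP] (G : circle_graph R n) := circle_graph_labelling (valP G).
have := card_wreath 'I_n; rewrite card_ord => <-.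
rewrite -cardsX.
pose F (p : circle_graph R n * ({perm 'I_n} * {ffun 'I_n -> bool})) :=
  (wreath p.2 * t p.1)%g.
have iso p : isomorphic (uadj (val p.1)) (crossing (dart_pos (F p))).
  apply: isomorphic_trans (tP _) _; rewrite isomorphic_sym; apply/asboolP.
  exists p.2.1; first by exists (p.2.1^-1)%g; [exact: permK|exact: permKV].
  move=> i j; rewrite -crossing_wreath; apply: crossing_mono => d e.
  by rewrite /F /dart_pos /= !permM.
have FI : injective F.
  move=> p q E; have G12 : p.1 = q.1.
    apply: val_inj; apply: ugraph_eq; apply: isomorphic_trans (iso p) _.
    by rewrite E isomorphic_sym; exact: iso.
  by case: p q G12 E => [G w] [H v] /= -> /mulIg/wreath_inj /= ->.
rewrite -(card_imset _ FI); apply: subset_leq_card; apply/fintype.subsetP.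
move=> _ /imsetP[p pP ->]; rewrite inE -(Qiso _ _ (iso p)).
by move: pP; rewrite !inE => /andP[].
Qed.

End Labelling.

Local Open Scope classical_set_scope.
Local Open Scope ring_scope.

(** * Far graphs are exponentially rare *)

Section FarGraphs.
Variable R : realType.

Definition density (V : finType) (e : rel V) k : R :=
  (n_cliques e k)%:R / 'C(#|V|, k)%:R.

Definition far_graphs n k (eps : R) : {set circle_graph R n} :=
  [set G : circle_graph R n |
     eps < `|density (uadj (val G)) k - cross_prob R k|]%SET.

(** The factors [2 ^ n * n!] and [n!] of the upper and lower counts cancel
against the number [(2 n)!] of arrangements, up to the polynomial loss of
[card_prime_circle]. *)
Lemma card_far_graphs : exists2 K : R, 0 <= K & forall n k (eps : R),
  (4 < n)%N -> (0 < k)%N -> (k <= n)%N -> 0 < eps <= 1 ->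
  #|far_graphs n k eps|%:R / #|{: circle_graph R n}|%:R <=
  K * n%:R ^+ 6 * expR (- (eps ^+ 2 / 8) * (n %/ k)%:R).
Proof.
have [K KP] := card_prime_circle; exists (2 * K%:R); first by rewrite mulr_ge0.
move=> [//|n'] k eps; set n := n'.+1 => n4 k0 kn e01.
set E := expR _; pose L := #|prime_circle n|; pose U := #|{: circle_graph R n}|.
have E0 : 0 <= E by exact: expR_ge0.
have A : (#|far_graphs n k eps| * (2 ^ n * n`!))%:R <= 2 * ((2 * n)`!)%:R * E :> R.
  have Qi (e e' : rel 'I_n) : isomorphic e e' ->
      (eps < `|density e k - cross_prob R k|) = (eps < `|density e' k - cross_prob R k|).
    by move=> ee'; rewrite /density (n_cliques_iso k ee').
  have := card_circle_graph_prop R Qi.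
  rewrite -(ler_nat R) => /le_trans; apply.
  apply: le_trans (card_far k0 kn e01); rewrite ler_nat.
  apply: subset_leq_card; apply/fintype.subsetP => t; rewrite !inE.
  by rewrite /density /clique_density card_ord.
have B : ((2 * n)`! <= K * (2 ^ n * n ^ 6 * L))%N by exact: KP.
have C : (L <= U * n`!)%N by exact: card_prime_circle_ub.
have U0 : (0 < U)%N.
  rewrite lt0n; apply/eqP => U0; move: (leq_trans B (leq_mul (leqnn K)
    (leq_mul (leqnn (2 ^ n * n ^ 6)) C))).
  by rewrite U0 mul0n !muln0 leqNgt fact_gt0.
have F0 : 0 < (2 ^ n * n`!)%:R :> R by rewrite ltr0n muln_gt0 expn_gt0 fact_gt0.
rewrite ler_pdivrMr ?ltr0n // -(ler_pM2r F0); rewrite natrM in A; apply: le_trans A _.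
have D : ((2 * n)`! <= K * (2 ^ n * n ^ 6 * (U * n`!)))%N.
  by apply: leq_trans B _; rewrite !leq_mul.
rewrite -(ler_nat R) in D.
have -> : 2 * K%:R * n%:R ^+ 6 * E * U%:R * (2 ^ n * n`!)%:R =
  2 * (K * (2 ^ n * n ^ 6 * (U * n`!)))%:R * E :> R.
  by rewrite -natrX; move: (n ^ 6)%N (2 ^ n)%N (n`!)%N => a b c; rewrite !natrM; ring.
by rewrite ler_wpM2r // ler_wpM2l.
Qed.

(** With c = d / (2 k), the decay is at least exp (- 2 c n) up to the factor
exp d due to the rounding in [n %/ k]; one half of it absorbs n ^ 6. *)
Lemma poly_expR_geometric (K d : R) k : 0 <= K -> 0 < d -> (0 < k)%N ->
  exists C z, [/\ 0 <= C, 0 < z, z < 1 & forall n,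
    K * n%:R ^+ 6 * expR (- d * (n %/ k)%:R) <= C * z ^+ n].
Proof.
move=> K0 d0 k0; have kR : 0 < k%:R :> R by rewrite ltr0n.
have [c c0 cE] : exists2 c : R, 0 < c & d / k%:R = 2 * c.
  by exists (d / k%:R / 2); [rewrite !divr_gt0|field; rewrite gt_eqF].
exists (K * (6`!%:R / c ^+ 6) * expR d), (expR (- c)); split.
- by rewrite !mulr_ge0 ?expR_ge0 // invr_ge0 exprn_ge0 // ltW.
- exact: expR_gt0.
- by rewrite expR_lt1 oppr_lt0.
move=> n; rewrite -expRM_natr.
have P : n%:R ^+ 6 <= (6`!%:R / c ^+ 6) * expR (c * n%:R) :> R.
  have x0 : 0 <= c * n%:R by rewrite mulr_ge0 // ltW.
  have := expR_ge1Dxn 5 x0; move: (expR _) => e H.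
  have {}H : (c * n%:R) ^+ 6 / 6`!%:R <= e by apply: le_trans H; rewrite lerDr.
  rewrite ler_pdivrMr ?ltr0n ?fact_gt0 // exprMn in H.
  by rewrite mulrAC ler_pdivlMr ?exprn_gt0 // mulrC [leRHS]mulrC.
have Q : - d * (n %/ k)%:R <= d - c * n%:R - c * n%:R.
  have : n%:R <= (n %/ k)%:R * k%:R + k%:R :> R.
    rewrite -natrM -natrD ler_nat; move: (divn_eq n k) (ltn_pmod n k0).
    by move: (n %/ k * k)%N (n %% k)%N => a b; lia.
  have -> : d - c * n%:R - c * n%:R = d - d / k%:R * n%:R.
    by rewrite cE; ring.
  rewrite -(ler_pM2l (divr_gt0 d0 kR)) => H.
  rewrite mulNr lerBrDr addrC lerBlDr; apply: le_trans H _.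
  by rewrite mulrDr mulrCA divfK ?gt_eqF // mulrC addrC.
apply: (@le_trans _ _ (K * ((6`!%:R / c ^+ 6) * expR (c * n%:R)) *
   expR (d - c * n%:R - c * n%:R))).
  apply: ler_pM; rewrite ?expR_ge0 ?ler_expR ?mulr_ge0 ?exprn_ge0 //.
  by rewrite ler_wpM2l.
rewrite -!mulrA ler_wpM2l // !ler_wpM2l ?invr_ge0 ?exprn_ge0 ?(ltW c0) //.
by rewrite -!expRD ler_expR; lra.
Qed.

End FarGraphs.

Lemma uniform_rv_seq (R : realType) (d : measure_display)
    (T : measurableType d) (P : probability T R) (U : finType) (X : T -> U)
    (r : seq U) : uniform_rv P X ->
  measurable (X @^-1` [set u | u \in r]) /\
  (P (X @^-1` [set u | u \in r]) <= ((size r)%:R / #|U|%:R)%:E)%E.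
Proof.
move=> hX; elim: r => [|u r [mr Pr]].
  have -> : X @^-1` [set u | u \in [::]] = set0 by apply/seteqP; split.
  by rewrite measure0 mul0r; split.
have -> : X @^-1` [set v | v \in u :: r] =
    X @^-1` [set u] `|` X @^-1` [set v | v \in r].
  apply/seteqP; split => w /=; rewrite inE.
    by move=> /orP[/eqP|]; [left|right].
  by case=> [->|->]; rewrite ?eqxx ?orbT.
have [mu Pu] := hX u; split; first exact: measurableU.
apply: le_trans; first exact: (measureU2 P mu mr).
rewrite /= -natr1 mulrDl mul1r addrC EFinD; apply: leeD => //.
by rewrite Pu.
Qed.

Lemma geometric_esum_lty (R : realType) (C z : R) : 0 < z -> z < 1 ->
  (\sum_(n <oo) (C * z ^+ n)%:E < +oo)%E.
Proof.
move=> z0 z1; have cg : cvgn (series (geometric C z)).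
  by apply: is_cvg_geometric_series; rewrite ger0_norm // ltW.
have -> : (fun n => \sum_(0 <= i < n) (C * z ^+ i)%:E)%E =
    EFin \o series (geometric C z).
  by apply/funext => n; rewrite /= /series /= sumEFin.
by rewrite EFin_lim // ltry.
Qed.

(** * Edges and triangles as cliques *)

Section SmallCliques.
Variables (V : finType) (e : rel V).
Hypotheses (es : symmetric e) (ei : irreflexive e).

Lemma n_edges_cliques : n_edges e = n_cliques e 2.
Proof.
have neq x y : e x y -> x != y by apply: contraTneq => ->; rewrite ei.
apply: eq_card => A; rewrite !inE; apply/imsetP/andP => [[[x y]]|[/cards2P]].
  rewrite inE /= => xy ->; rewrite cards2 neq //; split => //.
  apply/forall_inP => a; rewrite !inE => /orP[]/eqP->;
  by apply/forall_inP => b; rewrite !inE => /orP[]/eqP->; rewrite ?eqxx ?xy ?(es y) ?xy ?implybT.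
move=> [x [y [xy ->]]] /forall_inP/(_ x); rewrite !inE eqxx => /(_ isT).
move=> /forall_inP/(_ y); rewrite !inE eqxx orbT xy => /(_ isT) exy.
by exists (x, y).
Qed.

Lemma n_triangles_cliques : n_triangles e = n_cliques e 3.
Proof.
have neq x y : e x y -> x != y by apply: contraTneq => ->; rewrite ei.
apply: eq_card => A; rewrite !inE; apply/imsetP/andP => [[[[x y] z]]|[/eqP A3]].
  rewrite inE /= => /and3P[xy yz xz] ->; split.
    rewrite finset.setUC cardsU1 cards2 !inE neq // negb_or.
    by rewrite ![z == _]eq_sym !neq.
  apply/forall_inP => a; rewrite !inE -orbA => /or3P[]/eqP->;
  apply/forall_inP => b; rewrite !inE -orbA => /or3P[]/eqP->;
  by rewrite ?eqxx //= ?xy ?yz ?xz ?(es y x) ?(es z x) ?(es z y) ?xy ?yz ?xz ?implybT.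
have /card_gt0P[x xA] : (0 < #|A|)%N by rewrite A3.
have : #|A :\ x|%SET == 2%N by have := cardsD1 x A; rewrite xA A3; lia.
move=> /cards2P[y [z [yz E]]] /forall_inP cl.
have AE : A = (x |: [set y; z])%SET by rewrite -E finset.setD1K.
have adj a b : a \in A -> b \in A -> a != b -> e a b.
  by move=> aA bA ab; have /forall_inP/(_ b bA) := cl a aA; rewrite ab.
have yA : y \in A by rewrite AE !inE eqxx orbT.
have zA : z \in A by rewrite AE !inE eqxx !orbT.
have xN : x \notin (A :\ x)%SET by rewrite !inE eqxx.
rewrite E !inE negb_or in xN; case/andP: xN => xy xz.
exists (x, y, z); first by rewrite inE /= !adj.
by rewrite AE /= finset.setUA.
Qed.

End SmallCliques.

(** * Almost sure convergence *)

Section AlmostSure.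
Context (R : realType) (d : measure_display) (T : measurableType d)
  (P : probability T R).

(** The first Borel-Cantelli lemma, with a geometric bound on the probabilities. *)
Lemma ae_eventually_not (F : nat -> set T) (C z : R) : 0 < z -> z < 1 ->
  (forall n, measurable (F n)) -> (forall n, (P (F n) <= (C * z ^+ n)%:E)%E) ->
  {ae P, forall w, \forall n \near \oo, ~ F n w}.
Proof.
move=> z0 z1 mF PF; exists (lim_sup_set F); split.
- by apply: bigcapT_measurable => n; exact: bigcup_measurable.
- apply: lim_sup_set_cvg0 => //; apply: le_lt_trans (geometric_esum_lty C z0 z1).
  by apply: lee_nneseries => [n _ _|n _]; [exact: measure_ge0|exact: PF].
- move=> w /= nw n _; apply: contrapT => nF; apply: nw; exists n => // j /= nj Fj.
  by apply: nF; exists j.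
Qed.

Context (G : forall n : nat, T -> circle_graph R n)
  (hG : forall n : nat, (1 <= n)%N -> uniform_rv P (G n)).

Lemma ae_eventually_close k (eps : R) : (0 < k)%N -> 0 < eps <= 1 ->
  {ae P, forall w, \forall n \near \oo,
     `|density R (uadj (val (G n w))) k - cross_prob R k| <= eps}.
Proof.
move=> k0 e01; have [K K0 KP] := card_far_graphs R.
have d0 : 0 < eps ^+ 2 / 8 by case/andP: e01 => e0 _; rewrite divr_gt0 ?exprn_gt0.
have [C [z [C0 z0 z1 Cz]]] := poly_expR_geometric K0 d0 k0.
pose F n := if (4 + k < n)%N then G n @^-1` [set g | g \in enum (far_graphs n k eps)]
  else set0.
have FP n : measurable (F n) /\ (P (F n) <= (C * z ^+ n)%:E)%E.
  rewrite /F; case: ifP => [nk|_]; last first.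
    by rewrite measure0 lee_fin mulr_ge0 ?exprn_ge0 ?(ltW z0).
  have n1 : (1 <= n)%N by lia.
  have [mE PE] := uniform_rv_seq (enum (far_graphs n k eps)) (hG n1).
  split=> //; apply: le_trans PE _; rewrite lee_fin -cardE.
  by apply: le_trans (Cz n); apply: KP => //; lia.
have := ae_eventually_not z0 z1 (fun n => (FP n).1) (fun n => (FP n).2).
apply: filterS => w; apply: filterS2 (nbhs_infty_gt (4 + k)) => n nk.
rewrite /F nk /= mem_enum inE => /negP; by rewrite -leNgt.
Qed.

Lemma ae_density_cvg k : (0 < k)%N ->
  {ae P, forall w, density R (uadj (val (G n w))) k @[n --> \oo] --> cross_prob R k}.
Proof.
move=> k0; have : {ae P, forall w, forall j, \forall n \near \oo,
     `|density R (uadj (val (G n w))) k - cross_prob R k| <= j.+1%:R^-1}.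
  apply: ae_foralln => j; apply: ae_eventually_close => //.
  by rewrite invr_gt0 ltr0n /= invf_le1 ?ler1n.
apply: filterS => w H; apply/cvgrPdist_le => eps eps0.
have [j _ /(_ _ (leqnn j)) je] := near_infty_natSinv_lt (PosNum eps0).
apply: filterS (H j) => n; rewrite distrC => /le_trans; apply; exact: ltW.
Qed.

Lemma ae_cliques_cvg k : (0 < k)%N ->
  {ae P, forall w, (n_cliques (uadj (val (G n w))) k)%:R / 'C(n, k)%:R @[n --> \oo]
    --> cross_prob R k}.
Proof.
move=> k0; apply: filterS (ae_density_cvg k0) => w; rewrite /density.
by under eq_fun do rewrite card_ord.
Qed.

End AlmostSure.

Lemma uadj_sym n (G : ugraph n) : symmetric (uadj G).
Proof.
move=> x y; have /andP[_ /forallP/(_ x)/forallP/(_ y)/eqP] := valP (generic_quotient.repr G).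
by [].
Qed.

Lemma uadj_irr n (G : ugraph n) : irreflexive (uadj G).
Proof.
by move=> x; have /andP[/forallP/(_ x)/negPf] := valP (generic_quotient.repr G).
Qed.

Theorem mainTheorem6 (R : realType) (d : measure_display)
    (T : measurableType d) (P : probability T R)
    (G : forall n : nat, T -> circle_graph R n)
    (hG : forall n : nat, (1 <= n)%N -> uniform_rv P (G n)) :
  [/\ forall k : nat, (1 <= k)%N ->
        {ae P, forall w,
          (n_cliques (uadj (val (G n w))) k)%:R / 'C(n, k)%:R @[n --> \oo]
            --> ((2 ^ k * k`!)%:R / ((2 * k)`!)%:R : R)},
      {ae P, forall w,
        (n_edges (uadj (val (G n w))))%:R / 'C(n, 2)%:R @[n --> \oo]
          --> (1 / 3 : R)} &
      {ae P, forall w,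
        (n_triangles (uadj (val (G n w))))%:R / 'C(n, 3)%:R @[n --> \oo]
          --> (1 / 15 : R)}].
Proof.
split => [k k1||].
- exact: ae_cliques_cvg.
- have <- : cross_prob R 2 = 1 / 3.
    rewrite /cross_prob; have [-> ->] : (2 ^ 2 * 2`! = 8 /\ (2 * 2)`! = 3 * 8)%N by [].
    by rewrite natrM; field.
  apply: filterS (ae_cliques_cvg hG (isT : (0 < 2)%N)) => w.
  under [X in X @ _ --> _ -> _]eq_fun => n.
    rewrite -(n_edges_cliques (uadj_sym _) (uadj_irr _)); over.
  by [].
- have <- : cross_prob R 3 = 1 / 15.
    rewrite /cross_prob; have [-> ->] : (2 ^ 3 * 3`! = 48 /\ (2 * 3)`! = 15 * 48)%N by [].
    by rewrite natrM; field.
  apply: filterS (ae_cliques_cvg hG (isT : (0 < 3)%N)) => w.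
  under [X in X @ _ --> _ -> _]eq_fun => n.
    rewrite -(n_triangles_cliques (uadj_sym _) (uadj_irr _)); over.
  by [].
Qed.
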